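(* Let $R=k[x_0,\ldots,x_n]$ be a polynomial ring over a field $k$ of any characteristic, let $1\le c<s$ be integers, and let $\mathcal F=\{F_1,\ldots,F_s\}$ be a set of $s$ forms in $R$ such that any $c+1$ of them form a regular sequence. Let $I_{c,\mathcal F}=\bigcap_{1\le j_1<\cdots<j_c\le s}(F_{j_1},\ldots,F_{j_c})$. Then for any $m\ge 1$ the ideal $I_{c,\mathcal F}^{(m)}$ has c.i. quotients with respect to the order $\tau$ on its minimal generating set $\mathbf G_{c,(m)}$. Additionally, for any $M\in\mathbf G_{c,(m)}$ with $P(M)=[d_1,\ldots,d_t]$, one has: (1) $|\mathrm{set}(M)|=m(M_{(r)})-s+c-r$, if $P(M)=[c,\ldots,c,r]$ is the maximal element in $\mathcal P_{\le c}(m)$; and, if $P(M)$ is not the maximal element of $\mathcal P_{\le c}(m)$, setting $i_0:=i_0(P(M))$, (2) $|\mathrm{set}(M)|=c-d_{i_0}$, if $d_t=d_{i_0}$; (3) $|\mathrm{set}(M)|=c-d_{i_0}+m_{\mathrm{supp}(M_{(d_{i_0})})}(M_{(d_t)})-(s-c+d_t)$, if $d_t<d_{i_0}$. Moreover, if all forms in $\mathcal F$ have the same degree $\delta$, then $I_{c,\mathcal F}^{(m)}$ has $\delta$-c.i. quotients.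
   Context: Symbolic powers: $I^{(m)}=\bigcap_{P\in \mathrm{Ass}(R/I)}(I^mR_P\cap R)$. C.i. quotients: a homogeneous ideal $I$ has c.i. quotients with respect to a total order $h_1>h_2>\cdots>h_r$ on a minimal generating set $\{h_1,\ldots,h_r\}$ of $I$ if for every $1\le i\le r-1$ the ideal $(h_1,\ldots,h_i):h_{i+1}$ is a complete intersection ideal (generated by a regular sequence); $\mathrm{set}(h_{i+1})$ denotes a minimal generating set of $(h_1,\ldots,h_i):h_{i+1}$ and $\mathrm{set}(h_1)=\emptyset$. If in addition all forms in all the sets $\mathrm{set}(h_i)$ have the same degree $\delta$, then $I$ has $\delta$-c.i. quotients. Monomials in $\mathcal F$: a monomial in $\mathcal F$ is a product (possibly with repetition) of elements of $\mathcal F$. Under the hypothesis on $\mathcal F$ this product expression is unique up to order; $\mathrm{supp}(M)\subseteq\mathcal F$ is the set of elements occurring in $M$, and $M$ is squarefree if it is a product of distinct elements of $\mathcal F$. Every monomial $M$ has a unique normal form $M=M^{(1)}\cdots M^{(t)}$ with all $M^{(j)}$ squarefree and $\emptyset\neq\mathrm{supp}(M^{(i+1)})\subseteq\mathrm{supp}(M^{(i)})$. Put $\mathrm{Sdeg}_c(M)=\sum_{i=1}^t\max\{0,c-s+|\mathrm{supp}(M^{(i)})|\}$. The set $\mathbf G_{c,(m)}$ of all monomials $M$ in $\mathcal F$ with $\mathrm{Sdeg}_c(M)=m$ and $|\mathrm{supp}(M^{(j)})|\ge s+1-c$ for every $j$ is a minimal generating set of $I_{c,\mathcal F}^{(m)}$.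 Partitions: $\mathcal P_{\le c}(m)$ is the set of partitions $[d_1,\ldots,d_t]$ of $m$ (so $\sum d_j=m$) with $c\ge d_1\ge\cdots\ge d_t\ge 1$; $t$ is the length. For $M\in\mathbf G_{c,(m)}$ with normal form $M^{(1)}\cdots M^{(t)}$ put $d_j=|\mathrm{supp}(M^{(j)})|-(s-c)$ and write $M_{(d_j)}:=M^{(j)}$ (factors with equal $d_j$ coincide), so $M=M_{(d_1)}\cdots M_{(d_t)}$; $P(M):=[d_1,\ldots,d_t]\in\mathcal P_{\le c}(m)$. The order alex on $\mathcal P_{\le c}(m)$: $[d_1,\ldots,d_t]>_{\mathrm{alex}}[b_1,\ldots,b_u]$ iff $t<u$, or $t=u$ and $[d_1,\ldots,d_t]>_{\mathrm{lex}}[b_1,\ldots,b_u]$. The maximal element is $[c,\ldots,c,r]$, where $m=qc+r$ with $q\ge0$ and $1\le r\le c$. For a non-maximal $[\underline d]\in\mathcal P_{\le c}(m)$ the index of overlap is $i_0([\underline d])=\max\{j \mid \exists\,[\underline b]\in\mathcal P_{\le c}(m)\text{ with }[\underline b]>_{\mathrm{alex}}[\underline d]\text{ and }d_h=b_h\text{ for }1\le h\le j-1\}$. Order $\tau$ on $\mathbf G_{c,(m)}$: fix $F_1>F_2>\cdots>F_s$. For squarefree monomials $A\ne B$ with supports of the same size, $A>_{\mathrm{revlex}}B$ iff the largest index $i$ such that $F_i$ lies in exactly one of $\mathrm{supp}(A),\mathrm{supp}(B)$ has $F_i\in\mathrm{supp}(B)$. If $P(M)=P(M')=[d_1,\ldots,d_t]$,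 then $M'\gg_{\mathrm{revlex}}M$ iff there is $j\ge 1$ with $M'_{(d_i)}=M_{(d_i)}$ for all $i<j$ and $M'_{(d_j)}>_{\mathrm{revlex}}M_{(d_j)}$. Then $M>_\tau N$ iff $P(M)>_{\mathrm{alex}}P(N)$, or $P(M)=P(N)$ and $M\gg_{\mathrm{revlex}}N$. The function $m_B$: for $B=\{F_{b_1},\ldots,F_{b_h}\}\subseteq\mathcal F$ with $b_1<\cdots<b_h$ and a monomial $N$ in $B$, $m_B(N)=\max\{j\in\{1,\ldots,h\} \mid F_{b_j}\in\mathrm{supp}(N)\}$; $m(N)$ stands for $m_{\mathcal F}(N)$. *)

(* Defs.v *)
From HB Require Import structures.
From mathcomp Require Import all_boot all_order all_algebra.
From mathcomp Require Import mpoly.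

Set Implicit Arguments.
Unset Strict Implicit.
Unset Printing Implicit Defensive.

Import Order.TTheory GRing.Theory.

Section Ideals.
Local Open Scope ring_scope.
Variable R : comNzRingType.
Implicit Types (X I J P : R -> Prop) (f g h : seq R).

Definition ideal_span X : R -> Prop := fun x =>
  exists r (a y : 'I_r -> R), (forall i, X (y i)) /\ x = \sum_i a i * y i.

Definition ideal_of f : R -> Prop := ideal_span (fun x => x \in f).

Definition same_ideal I J : Prop := forall x, I x <-> J x.

Definition colon I x : R -> Prop := fun y => I (y * x).

Definition ideal_pow I m : R -> Prop :=
  ideal_span (fun x => exists2 y : 'I_m -> R, forall i, I (y i) & x = \prod_i y i).

Definition is_ideal I : Prop :=
  [/\ I 0, forall x y, I x -> I y -> I (x + y) & forall a x, I x -> I (a * x)].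

Definition prime_ideal P : Prop :=
  [/\ is_ideal P, ~ P 1 & forall x y, P (x * y) -> P x \/ P y].

(* P is in Ass(R/I): the annihilator of the class of some x is I : x. *)
Definition associated_prime I P : Prop :=
  prime_ideal P /\ exists x, same_ideal P (colon I x).

(* x lies in the contraction of I^m R_P to R iff u x is in I^m for some u
   outside P, since u becomes a unit in R_P. *)
Definition symbolic_power I m : R -> Prop := fun x =>
  forall P, associated_prime I P -> exists2 u, ~ P u & ideal_pow I m (u * x).

Definition regular_seq f : Prop :=
  ~ ideal_of f 1 /\
  forall i, (i < size f)%N -> forall x,
    ideal_of (take i f) (x * f`_i) -> ideal_of (take i f) x.

Definition complete_intersection J : Prop :=
  exists2 f, regular_seq f & same_ideal J (ideal_of f).

End Ideals.

Section CiQuotients.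
Local Open Scope ring_scope.
Variables (n : nat) (k : fieldType).
Notation R := {mpoly k[n]}.
Implicit Types (I J : R -> Prop) (S h : seq R).

Definition is_form (x : R) : Prop := exists d, x \is d.-homog.

(* Minimal generators of a homogeneous ideal are understood to be forms: this
   is what makes their number an invariant of J. *)
Definition min_gens J S : Prop :=
  [/\ {in S, forall x, is_form x}, same_ideal J (ideal_of S)
    & forall S', subseq S' S -> same_ideal J (ideal_of S') -> S' = S].

(* The list h is h_1 > h_2 > ... > h_r, so that h_(i+1) is h`_i; S is a
   possible value of set(h_(i+1)). *)
Definition is_set h i S : Prop :=
  if i is 0%N then S = [::] else min_gens (colon (ideal_of (take i h)) h`_i) S.

Definition ci_quotients I h : Prop :=
  min_gens I h /\
  forall i, (0 < i < size h)%N ->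
    complete_intersection (colon (ideal_of (take i h)) h`_i).

Definition delta_ci_quotients (delta : nat) I h : Prop :=
  ci_quotients I h /\
  forall i S, (i < size h)%N -> is_set h i S ->
    {in S, forall x, x \is delta.-homog}.

(* |set(h_(i+1))| = z, whichever minimal generating set is chosen. *)
Definition card_set_is h i (z : int) : Prop :=
  (exists S, is_set h i S) /\ forall S, is_set h i S -> (size S)%:Z = z.

End CiQuotients.

Section Partitions.
Implicit Types (c m : nat) (d b : seq nat).

Definition is_partition c m d : bool :=
  [&& sumn d == m, sorted geq d & all (fun x => 1 <= x <= c) d].

Definition alex d b : bool :=
  (size d < size b) ||
  (size d == size b) && ((b : seqlexi nat) < (d : seqlexi nat))%O.

Definition overlaps_at c m d j : Prop :=
  0 < j /\ exists b, [/\ is_partition c m b, alex b d & take j.-1 d = take j.-1 b].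

(* j is i_0([d]), with positions counted from 1. *)
Definition is_overlap_index c m d j : Prop :=
  overlaps_at c m d j /\ forall j', overlaps_at c m d j' -> j' <= j.

End Partitions.

(* A monomial in F = {F_1, ..., F_s} is encoded by its exponent vector, an
   element of 'X_{1..s}, and a squarefree one by its support.  The form F_i of
   the mathematical notation is F (i - 1), so that F_1 > ... > F_s is the
   increasing order of the indices in 'I_s. *)
Section Monomials.
Variables (s : nat).
Implicit Types (M N : 'X_{1..s}) (A B : {set 'I_s}) (c m : nat).

Definition mon_val (R : comNzRingType) (F : 'I_s -> R) M : R :=
  (\prod_i F i ^+ M i)%R.

Definition is_normal_form M (L : seq {set 'I_s}) : Prop :=
  [/\ set0 \notin L, sorted (fun A B => B \subset A) L
    & forall i, M i = count (fun A => i \in A) L].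

Definition nform M : seq {set 'I_s} :=
  [seq [set i | j < M i] | j <- iota 0 (\max_i M i)].

Lemma nformP M : is_normal_form M (nform M).
Proof.
split.
- apply/negP => /mapP[j]; rewrite mem_iota add0n /= => lt_j.
  have [i lt_ji] : exists i, j < M i.
    apply/existsP; apply: contraTT lt_j; rewrite negb_exists -leqNgt.
    by move/forallP => le_j; apply/bigmax_leqP => i _; rewrite leqNgt.
  by move/setP/(_ i); rewrite !inE lt_ji.
- rewrite /nform sorted_map.
  apply: sub_sorted (iota_ltn_sorted 0 _) => j j' /= lt_jj'.
  by apply/subsetP => i; rewrite !inE; apply: ltn_trans.
- move=> i; rewrite /nform count_map.
  rewrite (eq_count (a2 := fun j => j < M i)); last by move=> j /=; rewrite inE.
  have : M i <= \max_i M i by apply: (leq_bigmax i).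
  move: (\max_i M i) => t /subnKC <-; rewrite iotaD count_cat add0n.
  rewrite (eq_in_count (a2 := predT)) => [|j]; last by rewrite mem_iota.
  rewrite count_predT size_iota (eq_in_count (a2 := pred0)) ?count_pred0 ?addn0 //.
  by move=> j; rewrite mem_iota leqNgt => /andP[/negPf].
Qed.

Lemma nform_uniq M L : is_normal_form M L -> L = nform M.
Proof.
case=> L0 Lsorted ML.
have subT : transitive (fun A B : {set 'I_s} => B \subset A).
  by move=> B A C sBA sCB; apply: subset_trans sCB sBA.
have mem_nth_L : forall i j, j < size L -> (i \in nth set0 L j) = (j < M i).
  move=> i j; rewrite ML => {M ML}; elim: L j Lsorted {L0} => //= A L IHL j.
  rewrite (path_sortedE subT) => /andP[/allP sLA sL].
  case: j => [_|j ltj] /=.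
    have [//|notA] := boolP (i \in A); rewrite add0n -has_count.
    apply/esym/negbTE/hasPn => B /sLA /subsetP sBA.
    by apply: contra notA; apply: sBA.
  rewrite IHL //; have [_|notA] := boolP (i \in A); first by rewrite add1n ltnS.
  suff -> : count (fun B : {set 'I_s} => i \in B) L = 0 by [].
  apply/eqP; rewrite -leqn0 leqNgt -has_count; apply/hasPn => B /sLA /subsetP sBA.
  by apply: contra notA; apply: sBA.
have szL : size L = \max_i M i.
  apply/eqP; rewrite eqn_leq; apply/andP; split; last first.
    by apply/bigmax_leqP => i _; rewrite ML count_size.
  case: (posnP (size L)) => [->//|sz_gt0].
  have lt_sz : (size L).-1 < size L by rewrite prednK.
  have: nth set0 L (size L).-1 != set0.
    by apply: contraNneq L0 => <-; rewrite mem_nth.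
  case/set0Pn => i; rewrite mem_nth_L // prednK // => le_sz.
  by apply: leq_trans le_sz _; apply: (leq_bigmax i).
apply: (@eq_from_nth _ set0) => [|j lt_j]; first by rewrite size_map size_iota.
rewrite (nth_map 0) ?size_iota -?szL // nth_iota -?szL //.
by apply/setP => i; rewrite inE mem_nth_L.
Qed.

Definition Sdeg c M : nat := \sum_(A <- nform M) (c + #|A| - s).

Definition in_G c m M : bool :=
  (Sdeg c M == m) && all (fun A => s + 1 - c <= #|A|) (nform M).

Definition part c M : seq nat := [seq #|A| - (s - c) | A <- nform M].

(* The support of M_(d). *)
Definition factor c M d : {set 'I_s} := nth set0 (nform M) (index d (part c M)).

(* A >_revlex B *)
Definition revlex A B : bool :=
  [exists i, (i \in B :\: A) &&
     [forall j : 'I_s, (i < j) ==> ((j \in A) == (j \in B))]].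

(* M >>_revlex N *)
Definition ggrevlex M N : Prop :=
  exists j, [/\ j < size (nform M), take j (nform M) = take j (nform N)
              & revlex (nth set0 (nform M) j) (nth set0 (nform N) j)].

(* M >_tau N *)
Definition tau c M N : Prop :=
  alex (part c M) (part c N) \/ part c M = part c N /\ ggrevlex M N.

(* For j : 'I_#|B|, enum_val j is the index b_(j + 1) of the (j + 1)-st element
   of B, the enumeration being increasing. *)
Definition mfun B A : nat := \max_(j < #|B| | enum_val j \in A) j.+1.

Definition star_ideal (R : comNzRingType) (F : 'I_s -> R) c : R -> Prop :=
  fun x => forall A, #|A| = c -> ideal_of [seq F i | i in A] x.

(* G lists the set G_{c,(m)} in decreasing order for tau. *)
Fixpoint tau_decreasing c (G : seq 'X_{1..s}) : Prop :=
  if G is M :: G' then (forall N, N \in G' -> tau c M N) /\ tau_decreasing c G'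
  else True.

Definition tau_listing c m (G : seq 'X_{1..s}) : Prop :=
  G =i in_G c m /\ tau_decreasing c G.

End Monomials.

(* Main.v *)
Require Import Defs.
From mathcomp Require Import all_boot all_order all_algebra.
From mathcomp Require Import mpoly.
From mathcomp Require Import ring zify.
From Stdlib Require Import Classical.

(** Regularity of the forms is used in two places.  First, if |B| <= c, then
    dividing the ideal (F_j^(M_j + 1) : j in B) by the monomial F^M leaves
    exactly (F_j : j in B), as if the forms were variables
    (form_ideal_colon).  Second, if |B| < c, any two forms outside B are a
    regular sequence modulo (F_j : j in B) (linear_quotients_saturated).

    The c.i. quotients are in fact linear quotients in the forms.  Let
    M^(1), ..., M^(t) be the squarefree factors of M in G_{c,(m)}, D the
    support of M^(t-1) (all of F if t = 1) and E that of M^(t).  Let B consist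
    of the forms outside D and of those in D, outside E, that come before the
    last form of E.  If j is in B, then F_j M is a multiple of a generator that
    is larger than M (colon_set_tau).  Conversely a generator N > M has an
    exponent N_j > M_j at some j in B (tau_colon_set); so all larger generators
    lie in (F_j^(M_j + 1) : j in B), and the colon ideal of M is
    (F_j : j in B) (colon_idealE).  It has at most c - 1 generators, and
    counting B gives the formulas for |set(M)| (card_colon_set), where the
    index of overlap is the first position with d_i = d_(t-1) (overlap_index).
    The number and the degrees of the elements of set(M) are independent of
    its choice, by a graded Nakayama argument (min_gens_size, min_gens_homog).

    That the monomials in G_{c,(m)} generate the symbolic power goes through
    the intersection of the powers (F_j : j in A)^m over all sets A of c
    indices.  The symbolic power lies in the intersection, because the
    associated primes of (F_j : j in A) are associated to the star ideal and
    the quotients of consecutive powers of (F_j : j in A) are free over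
    R / (F_j : j in A) (symbolic_power_weight); existence of associated primes
    is where R is Noetherian.  The intersection lies in the ideal generated by
    G_{c,(m)}: monomials with large exponents outside some A multiply the
    intersection into this ideal, and the ideal is saturated with respect to
    any c + 1 of the forms since it has linear quotients on fewer than c forms
    each (weight_ideals_cap).  Finally, the generators lie in the symbolic
    power, as the product of the forms outside A multiplies
    (F_j : j in A) into the star ideal (weight_symbolic_power). *)

Set Implicit Arguments.
Unset Strict Implicit.
Unset Printing Implicit Defensive.

Import Order.TTheory GRing.Theory.

(** * Ideals as predicates *)

Section IdealBasics.
Local Open Scope ring_scope.
Variable R : comNzRingType.
Implicit Types (X I J P : R -> Prop) (f g h : seq R) (x y : R).

Lemma is_ideal0 I : is_ideal I -> I 0. Proof. by case. Qed.

Lemma is_idealD I x y : is_ideal I -> I x -> I y -> I (x + y).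
Proof. by case=> _ + _; apply. Qed.

Lemma is_idealMl I a x : is_ideal I -> I x -> I (a * x).
Proof. by case=> _ _; apply. Qed.

Lemma is_idealMr I a x : is_ideal I -> I x -> I (x * a).
Proof. by move=> idI Ix; rewrite mulrC; apply: is_idealMl. Qed.

Lemma is_idealB I x y : is_ideal I -> I x -> I y -> I (x - y).
Proof.
by move=> idI Ix Iy; apply: is_idealD => //; rewrite -mulN1r; apply: is_idealMl.
Qed.

Lemma is_ideal_sum I (T : Type) (r : seq T) (P : pred T) (E : T -> R) :
  is_ideal I -> (forall i, P i -> I (E i)) -> I (\sum_(i <- r | P i) E i).
Proof.
move=> idI IE; apply: (big_ind I) => //; first exact: is_ideal0.
by move=> x y; apply: is_idealD.
Qed.

Lemma ideal_span_ideal X : is_ideal (ideal_span X).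
Proof.
split.
- exists 0%N, (fun=> 0), (fun=> 0); split; first by case.
  by rewrite big_ord0.
- move=> _ _ [r [a [y [Xy ->]]]] [r' [a' [y' [Xy' ->]]]].
  exists (r + r')%N.
  exists (fun i => match split i with inl j => a j | inr j => a' j end).
  exists (fun i => match split i with inl j => y j | inr j => y' j end).
  split; first by move=> i; case: (split i).
  rewrite big_split_ord /=; congr (_ + _); apply: eq_bigr => i _.
    by rewrite (unsplitK (inl i)).
  by rewrite (unsplitK (inr i)).
- move=> b _ [r [a [y [Xy ->]]]]; exists r, (fun i => b * a i), y; split=> //.
  by rewrite mulr_sumr; apply: eq_bigr => i _; rewrite mulrA.
Qed.

Lemma ideal_span_gen X x : X x -> ideal_span X x.
Proof.
move=> Xx; exists 1%N, (fun=> 1), (fun=> x); split=> //.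
by rewrite big_ord_recl big_ord0 mul1r addr0.
Qed.

Lemma ideal_span_min X J : is_ideal J -> (forall x, X x -> J x) ->
  forall x, ideal_span X x -> J x.
Proof.
move=> idJ XJ _ [r [a [y [Xy ->]]]]; apply: is_ideal_sum => // i _.
by apply: is_idealMl => //; apply: XJ.
Qed.

Lemma ideal_span_sub X Y : (forall x, X x -> ideal_span Y x) ->
  forall x, ideal_span X x -> ideal_span Y x.
Proof. by move=> XY; apply: ideal_span_min XY; apply: ideal_span_ideal. Qed.

Lemma ideal_of_sub f g : {subset f <= g} -> forall x, ideal_of f x -> ideal_of g x.
Proof. by move=> fg; apply: ideal_span_sub => x /fg; apply: ideal_span_gen. Qed.

Lemma colon_ideal I x : is_ideal I -> is_ideal (colon I x).
Proof.
move=> idI; split; rewrite /colon.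
- by rewrite mul0r; apply: is_ideal0.
- by move=> y z Iy Iz; rewrite mulrDl; apply: is_idealD.
- by move=> a y Iy; rewrite -mulrA; apply: is_idealMl.
Qed.

(** Cancellation arguments single out one generator z; what remains has to lie
    in the ideal of the other generators. *)
Lemma ideal_span_or X Y z x : (forall y, X y -> y = z \/ Y y) ->
  ideal_span X x -> exists a y, ideal_span Y y /\ x = a * z + y.
Proof.
move=> XzY; have idY := ideal_span_ideal Y; move: x.
apply: (ideal_span_min (J := fun x => exists a y, _ y /\ x = a * z + y)).
  split.
  - by exists 0, 0; split; [apply: is_ideal0 | rewrite mul0r addr0].
  - move=> _ _ [a [y [Yy ->]]] [a' [y' [Yy' ->]]].
    by exists (a + a'), (y + y'); split; [apply: is_idealD | ring].
  - move=> b _ [a [y [Yy ->]]].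
    by exists (b * a), (b * y); split; [apply: is_idealMl | ring].
move=> y /XzY[->|Yy].
  by exists 1, 0; split; [apply: is_ideal0 | rewrite mul1r addr0].
by exists 0, y; split; [apply: ideal_span_gen | rewrite mul0r add0r].
Qed.

Lemma ideal_ofP f x :
  ideal_of f x -> exists a : 'I_(size f) -> R, x = \sum_i a i * f`_i.
Proof.
move: x; apply: (ideal_span_min (J := fun x => exists a : 'I_(size f) -> R, _)).
  split.
  - by exists (fun=> 0); rewrite big1 // => i _; rewrite mul0r.
  - move=> _ _ [a ->] [b ->]; exists (fun i => a i + b i).
    by rewrite -big_split; apply: eq_bigr => i _; rewrite mulrDl.
  - move=> b _ [a ->]; exists (fun i => b * a i).
    by rewrite mulr_sumr; apply: eq_bigr => i _; rewrite mulrA.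
move=> y yf; have lty : (index y f < size f)%N by rewrite index_mem.
exists (fun i => (i == Ordinal lty)%:R); rewrite (bigD1 (Ordinal lty)) //= eqxx.
rewrite mul1r nth_index // big1 ?addr0 // => i /negPf->; by rewrite mul0r.
Qed.

Lemma ideal_pow_ideal I m : is_ideal (ideal_pow I m).
Proof. exact: ideal_span_ideal. Qed.

Lemma ideal_pow0 I x : ideal_pow I 0 x.
Proof.
rewrite -[x]mulr1; apply: is_idealMl; first exact: ideal_pow_ideal.
apply: ideal_span_gen; exists (fun=> 0); first by case.
by rewrite big_ord0.
Qed.

Lemma ideal_powS I m x y : I x -> ideal_pow I m y -> ideal_pow I m.+1 (x * y).
Proof.
move=> Ix; move: y.
apply: (ideal_span_min (J := fun y => ideal_pow I m.+1 (x * y))).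
  have idI := ideal_pow_ideal I m.+1; split.
  - by rewrite mulr0; apply: is_ideal0.
  - by move=> y z Iy Iz; rewrite mulrDr; apply: is_idealD.
  - by move=> a y Iy; rewrite mulrCA; apply: is_idealMl.
move=> _ [y Iy ->]; apply: ideal_span_gen.
exists (fun i => if unlift ord0 i is Some j then y j else x).
  by move=> i; case: (unlift _ _).
by rewrite big_ord_recl unlift_none; congr (_ * _); apply: eq_bigr => i _; rewrite liftK.
Qed.

(** Membership in a power is used only through a filtration K with
    I K_j contained in K_(j + 1), such as the ideals spanned by the monomials
    of weight at least j. *)
Lemma ideal_pow_min I (K : nat -> R -> Prop) : (forall j, is_ideal (K j)) ->
  (forall x, K 0%N x) -> (forall j x y, I x -> K j y -> K j.+1 (x * y)) ->
  forall m x, ideal_pow I m x -> K m x.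
Proof.
move=> idK K0 KS m; apply: ideal_span_min => // _ [y Iy ->].
elim: m y Iy => [|m IHm] y Iy; first exact: K0.
by rewrite big_ord_recl; apply: KS => //; apply: IHm => i; apply: Iy.
Qed.

End IdealBasics.

(** * Noetherian rings and associated primes *)

Definition sub_ideal (R : comNzRingType) (I J : R -> Prop) := forall x, I x -> J x.

(** The maximum condition, rather than chains or finite generation: it is what
    the existence of associated primes uses, and it avoids dependent choice. *)
Definition noetherian (R : comNzRingType) : Prop :=
  forall Fam : (R -> Prop) -> Prop, (forall I, Fam I -> is_ideal I) ->
  (exists I, Fam I) ->
  exists2 I, Fam I & forall J, Fam J -> sub_ideal I J -> sub_ideal J I.

Section Noetherian.
Local Open Scope ring_scope.

Lemma noetherian_field (k : fieldType) : noetherian k.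
Proof.
move=> Fam idF [I0 FI0].
case: (classic (exists I, Fam I /\ I 1)) => [[I [FI I1]]|no1].
  exists I => // J FJ IJ x _; rewrite -[x]mulr1.
  by apply: is_idealMl => //; apply: idF.
exists I0 => // J FJ _ x Jx.
have [->|nzx] := eqVneq x 0; first by apply: is_ideal0; apply: idF.
case: no1; exists J; split=> //; rewrite -(mulVf nzx).
by apply: is_idealMl => //; apply: idF.
Qed.

Lemma noetherian_surj (R S : comNzRingType) (phi : {rmorphism R -> S}) :
  (forall y, exists x, y = phi x) -> noetherian R -> noetherian S.
Proof.
move=> surj noeR Fam idF [I0 FI0].
pose pre (I : S -> Prop) x := I (phi x).
have [||_ [I FI ->] maxI] := noeR (fun I => exists2 J, Fam J & I = pre J).
- move=> _ [J FJ ->]; have [J0 JD JM] := idF _ FJ; split; rewrite /pre.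
  + by rewrite rmorph0.
  + by move=> x y; rewrite rmorphD; apply: JD.
  + by move=> a x; rewrite rmorphM; apply: JM.
- by exists (pre I0), I0.
exists I => // J FJ IJ y; have [x ->] := surj y.
by apply: (maxI (pre J)) => [|x']; [exists J | apply: IJ].
Qed.

Section Hilbert.
Variable R : comNzRingType.
Implicit Types (I J : {poly R} -> Prop).

Definition lead_ideal I d : R -> Prop := fun a =>
  exists2 p : {poly R}, I p & (size p <= d.+1)%N /\ p`_d = a.

Lemma lead_ideal_ideal I d : is_ideal I -> is_ideal (lead_ideal I d).
Proof.
move=> idI; split.
- by exists 0; [apply: is_ideal0 | rewrite size_poly0 coef0].
- move=> _ _ [p Ip [sp <-]] [q Iq [sq <-]]; exists (p + q); first exact: is_idealD.
  by rewrite coefD (leq_trans (size_polyD _ _)) // geq_max sp sq.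
- move=> a _ [p Ip [sp <-]]; exists (a%:P * p); first exact: is_idealMl.
  by rewrite coefCM mul_polyC (leq_trans (size_scale_leq _ _)).
Qed.

Lemma lead_ideal_mono I J d : sub_ideal I J ->
  sub_ideal (lead_ideal I d) (lead_ideal J d).
Proof. by move=> IJ a [p Ip ?]; exists p => //; apply: IJ. Qed.

Lemma lead_ideal_incr I d e : is_ideal I -> (d <= e)%N ->
  sub_ideal (lead_ideal I d) (lead_ideal I e).
Proof.
move=> idI le_de _ [p Ip [sp <-]]; exists ('X^(e - d) * p); first exact: is_idealMl.
rewrite coefXnM ltnNge leq_subr /= subKn //; split=> //.
apply: leq_trans (size_polyMleq _ _) _; rewrite size_polyXn; lia.
Qed.

(** Leading coefficients detect equality: subtract an element of I with the
    same leading coefficient and argue on the degree. *)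
Lemma lead_ideal_eq I J : is_ideal I -> is_ideal J -> sub_ideal I J ->
  (forall d, sub_ideal (lead_ideal J d) (lead_ideal I d)) -> sub_ideal J I.
Proof.
move=> idI idJ IJ leadJI p; have [d] := ubnP (size p).
elim: d p => // -[_ p|d IHd p].
  by rewrite ltnS leqn0 size_poly_eq0 => /eqP-> _; apply: is_ideal0.
rewrite ltnS => lep Jp.
have [|q Iq [sq qd]] := leadJI d p`_d; first by exists p.
rewrite -[p](subrK q); apply: is_idealD => //; apply: IHd; last first.
  by apply: is_idealB => //; apply: IJ.
rewrite ltnS; apply/leq_sizeP => j; rewrite leq_eqVlt => /orP[/eqP<-|ltj].
  by rewrite coefB qd subrr.
by rewrite coefB !nth_default ?subrr //; [apply: leq_trans sq _ | apply: leq_trans lep _].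
Qed.

(** Hilbert's basis theorem: maximise first over all pairs (ideal, degree),
    which fixes the leading coefficients in degrees >= d0, and then in the
    finitely many degrees below d0, one after the other. *)
Lemma noetherian_poly : noetherian R -> noetherian {poly R}.
Proof.
move=> noeR Fam idF [I00 FI00].
have [||_ [I0 [d0 FI0 ->]] maxI0] :=
    noeR (fun a => exists I, exists2 d, Fam I & a = lead_ideal I d).
- by move=> _ [I [d FI ->]]; apply: lead_ideal_ideal; apply: idF.
- by exists (lead_ideal I00 0), I00, 0%N.
have {maxI0} stable0 J d : Fam J -> sub_ideal I0 J -> (d0 <= d)%N ->
    sub_ideal (lead_ideal J d) (lead_ideal I0 d).
  move=> FJ I0J led a Ja; apply: (lead_ideal_incr (idF _ FI0) led).
  apply: (maxI0 (lead_ideal J d)) Ja; first by exists J, d.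
  move=> b /(lead_ideal_mono I0J); exact: (lead_ideal_incr (idF _ FJ) led).
have [I FI [I0I stableI]] : exists2 I, Fam I & sub_ideal I0 I /\
    forall d, (d < d0)%N -> forall J, Fam J -> sub_ideal I J ->
    sub_ideal (lead_ideal J d) (lead_ideal I d).
  elim: d0 {stable0} => [|d [I FI [I0I stableI]]]; first by exists I0 => //; split=> // x.
  have [||_ [J [FJ IJ] ->] maxJ] :=
      noeR (fun a => exists2 J, Fam J /\ sub_ideal I J & a = lead_ideal J d).
  - by move=> _ [J [FJ _] ->]; apply: lead_ideal_ideal; apply: idF.
  - by exists (lead_ideal I d), I => //; split=> // x.
  exists J => //; split=> [x /I0I/IJ //|e].
  rewrite ltnS leq_eqVlt => /orP[/eqP->|lted] K FK JK.
    apply: maxJ; last exact: lead_ideal_mono.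
    by exists K => //; split=> // x /IJ/JK.
  move=> a /(stableI e lted K FK)-/(_ (fun x Ix => JK x (IJ x Ix))).
  exact: lead_ideal_mono.
exists I => // J FJ IJ; apply: lead_ideal_eq => //; try exact: idF.
move=> d; have [ltd|led] := ltnP d d0; first exact: stableI.
have I0J : sub_ideal I0 J by move=> x /I0I/IJ.
by move=> a /(stable0 _ _ FJ I0J led); apply: lead_ideal_mono.
Qed.

End Hilbert.

Lemma noetherian_mpoly (k : fieldType) n : noetherian {mpoly k[n]}.
Proof.
elim: n => [|n IHn].
  apply: (noetherian_surj (phi := @mpolyC 0 k)); last exact: noetherian_field.
  move=> p; exists p@_0%MM; apply/mpolyP => m; rewrite mcoeffC.
  have -> : m = 0%MM by apply/mnmP; case.
  by rewrite eqxx mulr1.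
have comX : commr_rmorph (@mwiden n k) ('X_ord_max) by move=> p; apply: mulrC.
apply: (noetherian_surj (phi := horner_morph comX)); last exact: noetherian_poly.
elim/mpolyind => [|c m p _ _ [x ->]]; first by exists 0; rewrite rmorph0.
pose m' := [multinom m (widen_ord (leqnSn n) i) | i < n].
exists ((c *: 'X_[m'])%:P * 'X^(m ord_max) + x).
rewrite rmorphD rmorphM rmorphXn /= horner_morphC horner_morphX; congr (_ + _).
transitivity (mwiden (c *: 'X_[m']) * 'X_ord_max ^+ m ord_max); last by [].
rewrite mwidenZ mwidenX -scalerAl mpolyXn -mpolyXD; congr (_ *: 'X_[_]).
apply/mnmP => i; rewrite mnmDE mulmnE mnm1E.
case: (unliftP ord_max i) => [j ->|->]; last first.
  by rewrite mnmwiden_ordmax eqxx mul1n.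
have -> : lift ord_max j = widen_ord (leqnSn n) j.
  by apply: val_inj; rewrite /= /bump leqNgt ltn_ord.
rewrite mnmwiden_widen mnmE eqE /= gtn_eqF ?mul0n ?addn0 //; exact: ltn_ord.
Qed.

(** A maximal element among the annihilators of the multiples of y modulo J is
    prime. *)
Lemma exists_assoc_prime (R : comNzRingType) (J : R -> Prop) y :
  noetherian R -> is_ideal J -> ~ J y ->
  exists b, prime_ideal (colon J (y * b)) /\ ~ J (y * b).
Proof.
move=> noeR idJ nJy.
have [||P [b ePb nJyb] maxP] :=
    noeR (fun P => exists2 b, P = colon J (y * b) & ~ J (y * b)).
- by move=> _ [b -> _]; apply: colon_ideal.
- by exists (colon J (y * 1)), 1 => //; rewrite mulr1.
exists b; split=> //; split; first exact: colon_ideal.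
  by rewrite /colon mul1r.
rewrite {}ePb in maxP * => u v Puv; apply: NNPP => /not_or_and[nPu nPv].
apply: nPv; apply: (maxP (colon J (y * (b * u)))).
- by exists (b * u) => //; rewrite mulrA mulrC.
- move=> z Jz; rewrite /colon (_ : _ * _ = u * (z * (y * b))); last by ring.
  exact: is_idealMl.
- by move: Puv; rewrite /colon; congr J; ring.
Qed.

End Noetherian.

(** * Forms any c + 1 of which form a regular sequence *)

Section MonVal.
Local Open Scope ring_scope.
Variables (R : comNzRingType) (s : nat) (F : 'I_s -> R).
Implicit Types (M N : 'X_{1..s}).

Lemma mon_val0 : mon_val F 0%MM = 1.
Proof. by rewrite /mon_val big1 // => i _; rewrite mnm0E expr0. Qed.

Lemma mon_valD M N : mon_val F (M + N)%MM = mon_val F M * mon_val F N.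
Proof.
by rewrite /mon_val -big_split; apply: eq_bigr => i _; rewrite mnmDE exprD.
Qed.

Lemma mon_valU i : mon_val F U_(i)%MM = F i.
Proof.
rewrite /mon_val (bigD1 i) //= mnm1E eqxx expr1 big1 ?mulr1 // => j ne.
by rewrite mnm1E eq_sym (negPf ne) expr0.
Qed.

Lemma mon_val_dvd M N : (N <= M)%MM -> mon_val F M = mon_val F (M - N)%MM * mon_val F N.
Proof. by move=> leNM; rewrite -mon_valD submK. Qed.

End MonVal.

Section RegularForms.
Local Open Scope ring_scope.
Variables (R : comNzRingType) (s c : nat) (F : 'I_s -> R).
Hypothesis regF : forall l : seq 'I_s, uniq l -> (size l <= c.+1)%N ->
  regular_seq [seq F i | i <- l].
Implicit Types (A B C : {set 'I_s}) (a : 'I_s -> nat) (M N : 'X_{1..s}).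

Definition power_ideal A a : R -> Prop :=
  ideal_span (fun y => exists2 j, j \in A & y = F j ^+ a j).

Notation form_ideal A := (ideal_of [seq F i | i in A]).

Lemma power_ideal_ideal A a : is_ideal (power_ideal A a).
Proof. exact: ideal_span_ideal. Qed.

Lemma form_ideal_ideal A : is_ideal (form_ideal A).
Proof. exact: ideal_span_ideal. Qed.

Hint Resolve power_ideal_ideal form_ideal_ideal : core.

Lemma form_ideal_gen A i : i \in A -> form_ideal A (F i).
Proof. by move=> iA; apply: ideal_span_gen; apply: image_f. Qed.

Lemma power_ideal_gen A a i : i \in A -> power_ideal A a (F i ^+ a i).
Proof. by move=> iA; apply: ideal_span_gen; exists i. Qed.

Lemma power_ideal_le A B a b : A \subset B -> {in A, forall i, b i <= a i}%N ->
  forall x, power_ideal A a x -> power_ideal B b x.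
Proof.
move=> /subsetP sAB le_ba; apply: ideal_span_min => // _ [j jA ->].
rewrite -(subnK (le_ba j jA)) exprD; apply: is_idealMl => //.
by apply: power_ideal_gen; apply: sAB.
Qed.

Lemma power_ideal1 A a : {in A, forall i, a i = 1%N} ->
  forall x, power_ideal A a x <-> form_ideal A x.
Proof.
move=> a1 x; split; move: x.
  apply: ideal_span_min => // _ [j jA ->].
  by rewrite a1 // expr1; apply: form_ideal_gen.
apply: ideal_span_min => // _ /imageP[j jA ->].
by rewrite -[F j]expr1 -(a1 j jA); apply: power_ideal_gen.
Qed.

Lemma form_ideal_sub A B : A \subset B -> forall x, form_ideal A x -> form_ideal B x.
Proof.
move=> /subsetP sAB; apply: ideal_span_sub => _ /imageP[i iA ->].
by apply: form_ideal_gen; apply: sAB.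
Qed.

Lemma power_ideal_split A a i x : power_ideal A a x ->
  exists w y, power_ideal (A :\ i) a y /\ x = w * F i ^+ a i + y.
Proof.
apply: ideal_span_or => _ [j jA ->].
have [->|ne] := eqVneq j i; [by left | right].
by exists j; rewrite // !inE ne.
Qed.

Lemma form_ideal_split A i x : form_ideal A x ->
  exists w y, form_ideal (A :\ i) y /\ x = w * F i + y.
Proof.
apply: ideal_span_or => _ /imageP[j jA ->].
have [->|ne] := eqVneq j i; [by left | right].
by apply: image_f; rewrite !inE ne.
Qed.

Lemma form_ideal_proper A : (#|A| <= c)%N -> ~ form_ideal A 1.
Proof.
move=> cA; have [|//] := regF (enum_uniq A).
by rewrite -cardE; apply: leqW.
Qed.

Lemma form_nzd A i x : (#|A| <= c)%N -> i \notin A ->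
  form_ideal A (x * F i) -> form_ideal A x.
Proof.
move=> cA niA; have [||_ /(_ (size (enum A)))] := regF (l := rcons (enum A) i).
- by rewrite rcons_uniq mem_enum niA enum_uniq.
- by rewrite size_rcons -cardE.
rewrite size_map size_rcons => /(_ (ltnSn _) x).
by rewrite map_rcons nth_rcons size_map ltnn eqxx -cats1 take_size_cat ?size_map.
Qed.

(** Regularity is inherited by powers of the forms.  If a_j >= 2, lower it by
    one: x F_i lies in the larger ideal, so x = y F_j^(a_j - 1) + q by
    induction, and cancelling F_j^(a_j - 1) reduces the claim to one about y
    in which a_j has become 1. *)
Lemma power_ideal_nzd A a i x : (#|A| <= c)%N -> i \notin A ->
  power_ideal A a (x * F i) -> power_ideal A a x.
Proof.
have [b] := ubnP (\sum_(j in A) a j); elim: b A a i x => // b IHb A a i x.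
rewrite ltnS => le_ab cA niA.
have nzd_exp A' a' j z e : (\sum_(l in A') a' l < b)%N -> (#|A'| <= c)%N ->
    j \notin A' -> power_ideal A' a' (z * F j ^+ e) -> power_ideal A' a' z.
  move=> lt cA' njA'; elim: e z => [|e IHe] z; first by rewrite mulr1.
  by rewrite exprS mulrA => /IHe; apply: IHb.
have [a1|/forall_inPn[j jA]] := boolP [forall j in A, a j == 1%N].
  have {}a1 : {in A, forall j, a j = 1%N} by move=> j /(forall_inP a1)/eqP.
  by move=> /(power_ideal1 a1)/form_nzd-/(_ cA niA)/(power_ideal1 a1).
case: (ltnP 1 (a j)) => [a_gt1 _|]; last first.
  case ea: (a j) => [|[|//]] // _ _ _; rewrite -[x]mulr1; apply: is_idealMl => //.
  by rewrite -(expr0 (F j)) -ea; apply: power_ideal_gen.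
pose a1 l := if l == j then (a j).-1 else a l.
pose a2 l := if l == j then 1%N else a l.
have nji : j != i by apply: contraNneq niA => <-.
have njD : j \notin A :\ j by rewrite !inE eqxx.
have cD : (#|A :\ j| <= c)%N by apply: leq_trans cA; apply/subset_leq_card/subD1set.
have sum_aj e : (\sum_(l in A) (if l == j then e else a l) =
    e + \sum_(l in A :\ j) a l)%N.
  rewrite (big_setD1 j) //= eqxx; congr (_ + _)%N; apply: eq_bigr => l.
  by rewrite !inE => /andP[/negPf->].
have sum_a : (\sum_(l in A) a l = a j + \sum_(l in A :\ j) a l)%N.
  by rewrite (big_setD1 j).
have lt1 : (\sum_(l in A) a1 l < b)%N by rewrite sum_aj; lia.
have lt2 : (\sum_(l in A) a2 l < b)%N by rewrite sum_aj; lia.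
have ltD : (\sum_(l in A :\ j) a l < b)%N by lia.
have aD l : l \in A :\ j -> (l == j) = false by rewrite !inE => /andP[/negPf].
have le_a1 : {in A, forall l, a1 l <= a l}%N.
  by move=> l _; rewrite /a1; case: eqP => // ->; apply: leq_pred.
move=> xFi; have /(power_ideal_le (subxx A) le_a1)/IHb := xFi.
move=> /(_ lt1 cA niA)/(power_ideal_split j)[y [q []]].
rewrite {2}/a1 eqxx => q1 ex.
have {q1} qD : power_ideal (A :\ j) a q.
  by apply: power_ideal_le q1 => // l /aD el; rewrite /a1 el.
have [w [q' [q'D exFi]]] := power_ideal_split j xFi.
have yw : power_ideal (A :\ j) a (y * F i - w * F j).
  apply: (@nzd_exp _ a j _ (a j).-1) => //.
  have -> : (y * F i - w * F j) * F j ^+ (a j).-1 = q' - q * F i.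
    have eaj : F j ^+ a j = F j * F j ^+ (a j).-1 by rewrite -exprS prednK //; lia.
    have -> : q' = x * F i - w * (F j * F j ^+ (a j).-1) by rewrite exFi eaj; ring.
    by rewrite ex; ring.
  by apply: is_idealB => //; apply: is_idealMr.
have /IHb : power_ideal A a2 (y * F i).
  rewrite -[y * F i](subrK (w * F j)); apply: is_idealD => //.
    by apply: power_ideal_le yw => [|l /aD el]; rewrite ?subD1set // /a2 el.
  apply: is_idealMl => //; rewrite -[F j]expr1.
  by have := power_ideal_gen a2 jA; rewrite /a2 eqxx.
move=> /(_ lt2 cA niA)/(power_ideal_split j)[v [q2 []]].
rewrite {2}/a2 eqxx => q2D ey.
have {}q2D : power_ideal (A :\ j) a q2.
  by apply: power_ideal_le q2D => // l /aD el; rewrite /a2 el.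
have -> : x = v * F j ^+ a j + (q2 * F j ^+ (a j).-1 + q).
  have -> : F j ^+ a j = F j * F j ^+ (a j).-1 by rewrite -exprS prednK //; lia.
  by rewrite ex ey; ring.
apply: is_idealD => //; first by apply: is_idealMl => //; apply: power_ideal_gen.
apply: (power_ideal_le (subD1set A j) (b := a)) => //.
by apply: is_idealD => //; apply: is_idealMr.
Qed.

(** The forms F_i with i in A lower the exponents one by one, and the others
    can be cancelled: relative to monomials, an ideal generated by powers of
    at most c forms behaves as if the forms were variables. *)
Lemma power_ideal_colon A a M x : (#|A| <= c)%N ->
  power_ideal A (fun i => M i + a i)%N (x * mon_val F M) -> power_ideal A a x.
Proof.
move=> cA; have [b] := ubnP (mdeg M); elim: b M x a => // b IHb M x a.
rewrite ltnS => leM; have [/forallP M0|/forallPn[i nzi]] := boolP [forall i, M i == 0%N].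
  have -> : mon_val F M = 1 by apply: big1 => i _; rewrite (eqP (M0 i)).
  by rewrite mulr1; apply: power_ideal_le => // i _; apply: leq_addl.
have leU : (U_(i) <= M)%MM.
  by apply/mnm_lepP => l; rewrite mnm1E; case: eqP => // <-; rewrite lt0n.
rewrite (mon_val_dvd F leU) mon_valU [_ * F i]mulrC mulrA => xM.
pose a' l := (a l + (l == i))%N.
have xFi : power_ideal A a' (x * F i).
  apply: (IHb (M - U_(i))%MM).
    by move: leM; rewrite -{1}(submK leU) mdegD mdeg1 addn1.
  apply: power_ideal_le xM => // l _; rewrite /a' mnmBE mnm1E eq_sym.
  have := mnm_lepP leU l; rewrite mnm1E eq_sym; lia.
have [iA|niA] := boolP (i \in A); last first.
  apply: (power_ideal_nzd cA niA); apply: power_ideal_le xFi => // l _.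
  exact: leq_addr.
have [w [y [yD]]] := power_ideal_split i xFi.
rewrite {1}/a' eqxx addn1 exprSr mulrA => /eqP; rewrite -subr_eq0 => /eqP e0.
have: power_ideal (A :\ i) a (x - w * F i ^+ a i).
  apply: (@power_ideal_nzd _ _ i); rewrite ?inE ?eqxx //.
    by apply: leq_trans cA; apply/subset_leq_card/subD1set.
  have -> : (x - w * F i ^+ a i) * F i = y.
    by apply/eqP; rewrite -subr_eq0 -e0; apply/eqP; ring.
  by apply: power_ideal_le yD => // l _; apply: leq_addr.
move=> xD; rewrite -[x](subrK (w * F i ^+ a i)); apply: is_idealD => //.
  by apply: power_ideal_le xD; rewrite ?subD1set.
by apply: is_idealMl => //; apply: power_ideal_gen.
Qed.

Lemma form_ideal_colon A M x : (#|A| <= c)%N ->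
  power_ideal A (fun i => (M i).+1) (x * mon_val F M) -> form_ideal A x.
Proof.
move=> cA; rewrite -(power_ideal1 (a := fun=> 1%N)) // => H.
apply: (power_ideal_colon (M := M)) => //.
by apply: power_ideal_le H => // i _; rewrite addn1.
Qed.

(** As |B| < c, two of the given c + 1 forms, F_i and F_j, form a regular
    sequence modulo (F_l : l in B).  Hence the coefficients of the last
    generator in the products x F_l, l in C, are multiples e F_l of one e;
    subtracting e times this generator from x leads one step down in the
    filtration of the ideal by its first generators. *)
Lemma linear_quotients_saturated (h : seq R) C x :
  (c < #|C|)%N ->
  (forall i, (i < size h)%N -> exists2 B : {set 'I_s}, (#|B| < c)%N &
     same_ideal (colon (ideal_of (take i h)) h`_i) (form_ideal B)) ->
  {in C, forall i, ideal_of h (x * F i)} -> ideal_of h x.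
Proof.
move=> cC quo xC; have idh (g : seq R) : is_ideal (ideal_of g) by apply: ideal_span_ideal.
suff [y hy yC] : exists2 y, ideal_of h (x - y) &
    {in C, forall i, ideal_of (take 0 h) (y * F i)}.
  have [i iC] : exists i, i \in C by apply/card_gt0P; apply: leq_trans cC.
  have /form_nzd-/(_ i y) : (#|set0 : {set 'I_s}| <= c)%N by rewrite cards0.
  rewrite in_set0 => /(_ isT).
  move: (yC i iC); rewrite take0 => yFi.
  have -> : [seq F i | i in set0 : {set 'I_s}] = [::] by rewrite /image_mem enum_set0.
  move=> /(_ yFi)/ideal_ofP[a ey].
  by move: hy; rewrite ey big_ord0 subr0.
suff yC d : (d <= size h)%N -> exists2 y, ideal_of h (x - y) &
    {in C, forall i, ideal_of (take (size h - d) h) (y * F i)}.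
  by rewrite -(subnn (size h)); apply: yC.
elim: d => [_|d IHd ltd].
  exists x => [|i iC]; first by rewrite subrr; apply: is_ideal0.
  by rewrite subn0 take_size; apply: xC.
have [//|y hy yC] := IHd _; first exact: ltnW.
set t := (size h - d.+1)%N; have ltt : (t < size h)%N by rewrite /t; lia.
have {IHd} yC l : l \in C -> exists p g,
    ideal_of (take t h) g /\ y * F l = p * h`_t + g.
  move=> /yC; have -> : (size h - d = t.+1)%N by rewrite /t; lia.
  rewrite (take_nth 0) //; apply: ideal_span_or => z.
  by rewrite mem_rcons inE => /predU1P.
have [B cB colonB] := quo t ltt.
have comm i j p q g g' : ideal_of (take t h) g -> ideal_of (take t h) g' ->
    y * F i = p * h`_t + g -> y * F j = q * h`_t + g' ->
    form_ideal B (p * F j - q * F i).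
  move=> hg hg' ei ej; apply/colonB; rewrite /colon.
  have -> : (p * F j - q * F i) * h`_t = g' * F i - g * F j.
    have -> : g = y * F i - p * h`_t by rewrite ei; ring.
    have -> : g' = y * F j - q * h`_t by rewrite ej; ring.
    by ring.
  by apply: is_idealB => //; apply: is_idealMr.
have [i [j [iC [niB [jC [njB nij]]]]]] : exists i j,
    i \in C /\ i \notin B /\ j \in C /\ j \notin B /\ i != j.
  have /card_gt1P[i [j [iD jD nij]]] : (1 < #|C :\: B|)%N.
    have := cardsID B C; have := subset_leq_card (subsetIr C B); lia.
  by exists i, j; move: iD jD; rewrite !inE => /andP[-> ->] /andP[-> ->].
have [p [g [hg ei]]] := yC i iC; have [q [g' [hg' ej]]] := yC j jC.
have [e [b [hb ep]]] : exists e b, form_ideal B b /\ p = e * F i + b.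
  have : form_ideal (i |: B) p.
    apply: (@form_nzd _ j); first by rewrite cardsU1 niB.
      by rewrite !inE negb_or njB eq_sym nij.
    rewrite -[p * F j](subrK (q * F i)); apply: is_idealD => //.
      by apply: form_ideal_sub (comm _ _ _ _ _ _ hg hg' ei ej); apply: subsetUr.
    by apply: is_idealMl => //; apply: form_ideal_gen; rewrite setU11.
  by move=> /(form_ideal_split i); rewrite setU1K.
exists (y - e * h`_t) => [|l lC].
  rewrite opprB addrA [x + _]addrC -addrA; apply: is_idealD => //.
  by apply: is_idealMl => //; apply: ideal_span_gen; apply: mem_nth.
have [r [g2 [hg2 el]]] := yC l lC.
have -> : (y - e * h`_t) * F l = (r - e * F l) * h`_t + g2.
  by rewrite mulrBl el; ring.
apply: is_idealD => //; suff /colonB : form_ideal B (r - e * F l) by [].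
apply: (@form_nzd _ i) => //; first exact: ltnW.
have -> : (r - e * F l) * F i = (r * F i - p * F l) + b * F l by rewrite ep; ring.
by apply: is_idealD => //; [apply: comm hg2 hg el ei | apply: is_idealMr].
Qed.

End RegularForms.

(** * Minimal generating sets of homogeneous ideals *)

Section MinimalGenerators.
Local Open Scope ring_scope.
Variables (n : nat) (k : fieldType).
Notation R := {mpoly k[n]}.
Implicit Types (I J : R -> Prop) (S : seq R) (b f : R).

Lemma mcoeff_pihomog d b (u : 'X_{1..n}) :
  (pihomog mdeg d b)@_u = if mdeg u == d then b@_u else 0.
Proof.
have [<-|ne] := eqVneq (mdeg u) d; last exact: dhomog_nemf_coeff (pihomogP _ _ _) ne.
have lt : (mdeg u < maxn (mmeasure mdeg b) (mdeg u).+1)%N by rewrite leq_max leqnn orbT.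
have := pihomog_partitionE (leq_maxl (mmeasure mdeg b) (mdeg u).+1).
move/(congr1 (mcoeff u)); rewrite raddf_sum => ->.
rewrite (bigD1 (Ordinal lt)) //= big1 ?addr0 // => i ne.
by apply: dhomog_nemf_coeff (pihomogP _ _ _) _; apply: contraNneq ne => e; apply/eqP/val_inj.
Qed.

Lemma pihomogM e d b f : f \is e.-homog ->
  pihomog mdeg d (b * f) = (if (e <= d)%N then pihomog mdeg (d - e) b else 0) * f.
Proof.
move=> fe; have := leq_maxl (mmeasure mdeg b) d.+1.
set K := maxn _ _ => leK; have eb := pihomog_partitionE leK.
rewrite {1}eb mulr_suml raddf_sum /=.
have sumE i : pihomog mdeg d (pihomog mdeg i b * f) =
    (if (i + e)%N == d then pihomog mdeg i b else 0) * f.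
  have hom : pihomog mdeg i b * f \is (i + e).-homog by rewrite dhomogM ?pihomogP.
  case: eqP => [<-|/eqP ne]; first exact: pihomog_dE.
  by rewrite mul0r; apply: pihomog_ne0 hom.
under eq_bigr do rewrite sumE.
rewrite -mulr_suml; congr (_ * f); case: (leqP e d) => led; last first.
  by apply: big1 => i _; case: eqP => //; lia.
have ltd : (d - e < K)%N by rewrite /K leq_max; apply/orP; right; lia.
rewrite (bigD1 (Ordinal ltd)) //= subnK // eqxx big1 ?addr0 // => i ne.
case: eqP => // e0; case/eqP: ne; apply: val_inj => /=; lia.
Qed.

Lemma pihomog0E b : pihomog mdeg 0 b = (b@_0%MM)%:MP.
Proof.
apply/mpolyP => u; rewrite mcoeff_pihomog mcoeffC mdeg_eq0.
by case: eqP => [->|]; rewrite ?mulr1 ?mulr0.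
Qed.

(** A relation between minimal generators has no invertible coefficient: its
    homogeneous component in the degree of the i-th generator would express
    this generator through the others. *)
Lemma min_gens_syzygy J S (b : 'I_(size S) -> R) : min_gens J S ->
  \sum_i b i * S`_i = 0 -> forall i, (b i)@_0%MM = 0.
Proof.
case=> formS JS minS rel i; apply/eqP/negPn/negP => nz.
have [d Si_d] := formS _ (mem_nth 0 (ltn_ord i)).
pose S' := take i S ++ drop i.+1 S.
have eS : S = take i S ++ S`_i :: drop i.+1 S.
  by rewrite -drop_nth ?cat_take_drop.
have S'_mem (l : 'I_(size S)) : l != i -> S`_l \in S'.
  rewrite neq_ltn => /orP[ltli|ltil]; rewrite mem_cat; apply/orP; [left|right].
    by rewrite -(nth_take 0 ltli) mem_nth // size_take_min leq_min ltli ltn_ord.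
  rewrite -(subnKC ltil) -nth_drop mem_nth // size_drop ltn_sub2r ?ltn_ord //.
    exact: leq_ltn_trans ltil (ltn_ord l).
have idS' : is_ideal (ideal_of S') by apply: ideal_span_ideal.
have SiS' : ideal_of S' S`_i.
  have -> : S`_i = ((b i)@_0%MM)^-1%:MP * (((b i)@_0%MM)%:MP * S`_i).
    by rewrite mulrA -mpolyCM mulVf // mul1r.
  apply: is_idealMl => //.
  have := congr1 (pihomog mdeg d) rel; rewrite raddf_sum raddf0 (bigD1 i) //=.
  rewrite (pihomogM _ _ Si_d) leqnn subnn pihomog0E => /eqP.
  rewrite addr_eq0 => /eqP->; rewrite -mulN1r; apply: is_idealMl => //.
  apply: is_ideal_sum => //. move=> l ne.
  have [e Sl_e] := formS _ (mem_nth 0 (ltn_ord l)).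
  rewrite (pihomogM _ _ Sl_e); apply: is_idealMl => //.
  by apply: ideal_span_gen; apply: S'_mem.
have subS' : subseq S' S.
  by rewrite [X in subseq _ X]eS cat_subseq // subseq_cons.
have /(congr1 size) : S' = S.
  apply: minS => // x; rewrite JS; split; last exact/ideal_of_sub/mem_subseq.
  apply: ideal_span_min => // y yS.
  have ltj : (index y S < size S)%N by rewrite index_mem.
  rewrite -(nth_index 0 yS); have [ei|ne] := eqVneq i (Ordinal ltj).
    by move: SiS'; rewrite ei.
  by apply: ideal_span_gen; apply: (S'_mem (Ordinal ltj)); rewrite eq_sym.
by rewrite [in RHS]eS !size_cat /= addnS => /eqP; rewrite eqn_leq ltnn andbF.
Qed.

Lemma min_gens_size_le J S S' : min_gens J S -> min_gens J S' ->
  (size S <= size S')%N.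
Proof.
move=> minS minS'; have [_ JS _] := minS; have [_ JS' _] := minS'.
have JSi (i : 'I_(size S)) : exists t : 'I_(size S') -> R,
    S`_i = \sum_j t j * S'`_j.
  by apply/ideal_ofP/JS'/JS/ideal_span_gen/mem_nth.
have JS'j (j : 'I_(size S')) : exists u : 'I_(size S) -> R,
    S'`_j = \sum_i u i * S`_i.
  by apply/ideal_ofP/JS/JS'/ideal_span_gen/mem_nth.
have [T eT] := fin_all_exists JSi; have [U eU] := fin_all_exists JS'j.
pose mx p q (X : 'I_p -> 'I_q -> R) := (\matrix_(i, j) (X i j)@_0%MM : 'M[k]_(p, q)).
apply: (@mulmx1_min _ _ _ (mx _ _ T) (mx _ _ U)).
apply/matrixP => i l; rewrite !mxE.
pose b l := \sum_j T i j * U j l - (i == l)%:R.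
have rel : \sum_l b l * S`_l = 0.
  under eq_bigr do rewrite mulrBl; rewrite sumrB; apply/eqP; rewrite subr_eq0.
  rewrite [eqbRHS](bigD1 i) //= eqxx mul1r [X in _ == _ + X]big1 ?addr0; last first.
    by move=> l'; rewrite eq_sym => /negPf->; rewrite mul0r.
  rewrite [in eqbRHS](eT i); under eq_bigr do rewrite mulr_suml.
  rewrite exchange_big; apply/eqP/eq_bigr => j _.
  by rewrite eU mulr_sumr; apply: eq_bigr => l' _; rewrite mulrA.
have := min_gens_syzygy minS rel l; rewrite /b raddfB raddf_sum /= => /eqP.
rewrite subr_eq0 (rmorph_nat (mcoeff 0%MM)) => /eqP <-; apply: eq_bigr => j _.
by rewrite !mxE -rmorphM.
Qed.

Lemma min_gens_size J S S' : min_gens J S -> min_gens J S' -> size S = size S'.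
Proof.
by move=> mS mS'; apply/eqP; rewrite eqn_leq !(min_gens_size_le (J := J)).
Qed.

Lemma min_gens_homog J S S0 delta : same_ideal J (ideal_of S0) ->
  {in S0, forall x, x \is delta.-homog} -> min_gens J S ->
  {in S, forall x, x \is delta.-homog}.
Proof.
move=> JS0 homS0 [formS JS minS].
have low e x : J x -> x \is e.-homog -> (e < delta)%N -> x = 0.
  move=> /JS0/ideal_ofP[b ->] /pihomog_dE <- lt; rewrite raddf_sum /=.
  apply: big1 => i _; rewrite (pihomogM _ _ (homS0 _ (mem_nth 0 (ltn_ord i)))).
  by rewrite leqNgt lt mul0r.
pose S' := [seq x <- S | x \is delta.-homog].
suff <- : S' = S by move=> x; rewrite mem_filter => /andP[].
apply: minS; first exact: filter_subseq.
have idS' : is_ideal (ideal_of S') by apply: ideal_span_ideal.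
move=> x; split; last first.
  by move=> xS'; apply/JS; apply: ideal_of_sub xS'; apply/mem_subseq/filter_subseq.
move/JS0; apply: ideal_span_min => // f fS0.
have /JS/ideal_ofP[b ef] : J f by apply/JS0/ideal_span_gen.
rewrite -(pihomog_dE (homS0 _ fS0)) ef raddf_sum /=; apply: is_ideal_sum => // i _.
have iS := mem_nth 0 (ltn_ord i); have [e Se] := formS _ iS.
rewrite (pihomogM _ _ Se).
case: (ltngtP e delta) => [lt|_|ee]; last 2 first.
- by rewrite mul0r; apply: is_ideal0.
- apply: is_idealMl => //; apply: ideal_span_gen.
  by rewrite mem_filter iS -ee Se.
rewrite (low e S`_i) ?mulr0 //; first exact: is_ideal0.
by apply/JS/ideal_span_gen.
Qed.

Lemma min_gens_map (T : eqType) (f : T -> R) (l : seq T) : uniq l ->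
  {in l, forall t, is_form (f t)} ->
  {in l, forall t, ~ ideal_of [seq f u | u <- l & u != t] (f t)} ->
  min_gens (ideal_of (map f l)) (map f l).
Proof.
move=> uniq_l form_l indep; split=> //; first by move=> _ /mapP[t tl ->]; apply: form_l.
move=> _ /subseqP[b _ ->]; rewrite -map_mask => same; congr map.
have sub := mask_subseq b l.
have [sub_l|/allPn[t tl tb]] := boolP (all (mem (mask b l)) l).
  apply/eqP; rewrite -(size_subseq_leqif sub).2 eqn_leq size_subseq //.
  by apply: uniq_leq_size => // x /(allP sub_l).
case: (indep t tl); have /same : ideal_of (map f l) (f t).
  by apply: ideal_span_gen; apply: map_f.
apply: ideal_of_sub => _ /mapP[u ub ->]; apply: map_f.
by rewrite mem_filter (mem_subseq sub ub) andbT; apply: contraNneq tb => <-.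
Qed.

End MinimalGenerators.

(** * Layers of a monomial *)

Section Layers.
Variables (s : nat).
Implicit Types (M N : 'X_{1..s}) (A B : {set 'I_s}) (c m k : nat) (i j : 'I_s).

(** The (k+1)-st squarefree factor of M; indexing by all k, with empty layers
    from the height on, spares every discussion of lengths of normal forms. *)
Definition layer M k : {set 'I_s} := [set i | k < M i].

Definition height M : nat := \max_i M i.

Definition excess c M k : nat := #|layer M k| - (s - c).

Lemma in_layer M k i : (i \in layer M k) = (k < M i).
Proof. by rewrite inE. Qed.

Lemma leq_height M i : M i <= height M.
Proof. exact: (leq_bigmax i). Qed.

Lemma height_attained M : 0 < height M -> exists i, M i = height M.
Proof.
case: (posnP #|'I_s|) => [c0|c_gt0 _]; last first.
  by have [i e] := bigop.eq_bigmax (fun i => M i) c_gt0; exists i.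
by rewrite /height big_pred0 // => i; have := card0_eq c0 i.
Qed.

Lemma layer_height M k : height M <= k -> layer M k = set0.
Proof.
move=> le_hk; apply/setP => i; rewrite !inE ltnNge.
by rewrite (leq_trans (leq_height M i)).
Qed.

Lemma layer_sub M k l : k <= l -> layer M l \subset layer M k.
Proof. by move=> le_kl; apply/subsetP => i; rewrite !inE; apply: leq_ltn_trans. Qed.

Lemma layer_inj M N : (forall k, layer M k = layer N k) -> M = N.
Proof.
move=> e; have le_e M' N' i : layer M' =1 layer N' -> M' i <= N' i.
  by move=> e'; rewrite leqNgt -in_layer e' in_layer ltnn.
by apply/mnmP => i; apply/eqP; rewrite eqn_leq !le_e.
Qed.

Lemma nformE M : nform M = [seq layer M k | k <- iota 0 (height M)].
Proof. by []. Qed.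

Lemma size_nform M : size (nform M) = height M.
Proof. by rewrite size_map size_iota. Qed.

Lemma nth_nform M k : nth set0 (nform M) k = layer M k.
Proof.
have [ltk|lek] := ltnP k (height M).
  by rewrite nformE (nth_map 0) ?size_iota // nth_iota.
by rewrite nth_default ?size_nform // layer_height.
Qed.

Lemma size_part c M : size (part c M) = height M.
Proof. by rewrite size_map size_nform. Qed.

Lemma nth_part c M k : nth 0 (part c M) k = excess c M k.
Proof.
have [ltk|lek] := ltnP k (height M).
  by rewrite (nth_map set0) ?size_nform // nth_nform.
by rewrite nth_default ?size_part // /excess layer_height // cards0.
Qed.

Lemma sumn_nth (d : seq nat) T : size d <= T -> sumn d = \sum_(k < T) nth 0 d k.
Proof.
elim: d T => [|x d IHd] T; first by rewrite big1 // => k; rewrite nth_nil.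
by case: T => //= T /IHd->; rewrite big_ord_recl.
Qed.

Lemma sumn_part c M : c <= s -> sumn (part c M) = Sdeg c M.
Proof.
by move=> le_cs; rewrite sumnE big_map; apply: eq_bigr => A _; lia.
Qed.

Lemma Sdeg_layers c M T : c <= s -> height M <= T ->
  Sdeg c M = \sum_(k < T) excess c M k.
Proof.
move=> le_cs le_hT; rewrite -sumn_part // (@sumn_nth _ T) ?size_part //.
by apply: eq_bigr => k _; rewrite nth_part.
Qed.

Lemma in_GP c m M : c <= s ->
  reflect (Sdeg c M = m /\ forall k, k < height M -> s - c < #|layer M k|)
          (in_G c m M).
Proof.
move=> le_cs; apply: (iffP andP) => -[].
  move=> /eqP eS /allP big; split=> // k ltk.
  have: layer M k \in nform M by rewrite -nth_nform mem_nth ?size_nform.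
  by move/big; lia.
move=> -> big; split=> //; apply/allP => A /mapP[k]; rewrite mem_iota => /= /big.
by move=> bigk ->; rewrite addn1 subSn.
Qed.

Lemma in_G_excess c m M k : c <= s -> in_G c m M -> k < height M ->
  #|layer M k| = excess c M k + (s - c) /\ 0 < excess c M k.
Proof. by move=> le_cs /(in_GP _ _ le_cs)[_ big] /big; rewrite /excess; lia. Qed.

Lemma sum_layers M A T : height M <= T ->
  \sum_(i in A) M i = \sum_(k < T) #|A :&: layer M k|.
Proof.
move=> le_hT; under [RHS]eq_bigr do rewrite -sum1_card big_mkcond /=.
under [RHS]eq_bigr => k _ do under eq_bigr => i _ do rewrite in_setI inE.
rewrite exchange_big /= big_mkcond; apply: eq_bigr => i _.
case: (i \in A) => /=; last by rewrite big1.
have le_MT : M i <= T by apply: leq_trans le_hT; apply: leq_height.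
by rewrite -big_mkcond (big_ord_narrow le_MT) sum1_card card_ord.
Qed.

(** At most s - c elements of a layer lie outside A. *)
Lemma excess_le c M A k : #|A| = c -> excess c M k <= #|A :&: layer M k|.
Proof.
move=> cA; have := cardsID A (layer M k); rewrite setIC.
have := subset_leq_card (subsetDr (layer M k) A).
have := cardsC A; rewrite card_ord /excess; lia.
Qed.

Lemma excess_eq c M A k : #|A| = c -> ~: A \subset layer M k ->
  excess c M k = #|A :&: layer M k|.
Proof.
move=> cA sub; have := cardsID A (layer M k); rewrite [_ :&: A]setIC.
have := cardsC A; rewrite card_ord /excess.
suff -> : layer M k :\: A = ~: A by lia.
by rewrite setDE; apply/setIidPr.
Qed.

Lemma excess_eqP c M A k : c <= s -> #|A| = c -> s - c < #|layer M k| ->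
  excess c M k = #|A :&: layer M k| -> ~: A \subset layer M k.
Proof.
move=> le_cs cA big; have := cardsID A (layer M k); rewrite [_ :&: A]setIC.
have := cardsC A; rewrite card_ord /excess => cAC cD e.
have le_out : #|~: A| <= #|layer M k :\: A| by lia.
have : layer M k :\: A == ~: A by rewrite eqEcard le_out setDE subsetIr.
by rewrite setDE => /eqP/setIidPr.
Qed.

Lemma Sdeg_le_sum c M A : c <= s -> #|A| = c -> Sdeg c M <= \sum_(i in A) M i.
Proof.
move=> le_cs cA; rewrite (Sdeg_layers le_cs (leqnn _)) (sum_layers A (leqnn _)).
by apply: leq_sum => k _; apply: excess_le.
Qed.

Lemma Sdeg_ge c m M A : c <= s -> #|A| = c -> (forall i, i \notin A -> m <= M i) ->
  m <= \sum_(i in A) M i -> m <= Sdeg c M.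
Proof.
move=> le_cs cA MA leA.
rewrite (Sdeg_layers (T := maxn m (height M)) le_cs (leq_maxr _ _)).
pose N := [multinom minn m (M i) | i < s].
have leN : height N <= m by apply/bigmax_leqP => i _; rewrite mnmE geq_minl.
apply: (@leq_trans (\sum_(i in A) N i)).
  have [/exists_inP[i iA leM]|/exists_inPn small] := boolP [exists i in A, m <= M i].
    by rewrite (bigD1 i) //= mnmE (minn_idPl leM) leq_addr.
  rewrite (leq_trans leA) // leq_sum // => i /small; rewrite mnmE -ltnNge => /ltnW.
  by move/minn_idPr->.
rewrite (sum_layers A leN).
rewrite -(big_mkord xpredT (fun k => #|A :&: layer N k|)).
rewrite -(big_mkord xpredT (fun k => excess c M k)).
rewrite (big_cat_nat (n := m) (p := maxn _ _)) ?leq_maxl //=.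
apply: leq_trans (leq_addr _ _); rewrite !big_mkord leq_sum // => k _.
rewrite (excess_eq cA).
  apply/subset_leq_card/setIS/subsetP => i; rewrite !inE mnmE => /leq_trans; apply.
  exact: geq_minr.
by apply/subsetP => i; rewrite !inE => /MA; apply: leq_trans.
Qed.

(** Removing one form from a monomial lowers its Sdeg by at most one, so a
    monomial minimal under division among those with Sdeg >= m has Sdeg = m
    and no layer that could be dropped. *)
Lemma in_G_below c m N : c <= s -> m <= Sdeg c N ->
  exists2 M, in_G c m M & (M <= N)%MM.
Proof.
move=> le_cs; have [b] := ubnP (mdeg N); elim: b N => // b IHb N; rewrite ltnS.
move=> leNb leN.
have excess_sub i k : excess c (N - U_(i))%MM k =
    if k.+1 == N i then (#|layer N k| - 1 - (s - c)) else excess c N k.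
  rewrite /excess; case: eqP => [ek|nk].
    have -> : layer (N - U_(i))%MM k = layer N k :\ i.
      apply/setP => j; rewrite !inE mnmBE mnm1E eq_sym.
      by case: eqP => [->|_]; rewrite ?subn0 //= -ek subn1 ltnn.
    by rewrite [in RHS](cardsD1 i) in_layer -ek leqnn addKn.
  congr (#|pred_of_set _| - _); apply/setP => j; rewrite !inE mnmBE mnm1E.
  by case: eqP => [<-|_]; [lia | rewrite subn0].
have le_h i : height (N - U_(i))%MM <= height N.
  apply/bigmax_leqP => j _; rewrite mnmBE.
  by apply: leq_trans (leq_subr _ _) (leq_height _ _).
have [/existsP[i /andP[Ni leNi]]|/existsPn small] :=
    boolP [exists i, (0 < N i) && (m <= Sdeg c (N - U_(i))%MM)].
  have leU : (U_(i) <= N)%MM.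
    by apply/mnm_lepP => l; rewrite mnm1E; case: eqP => // <-.
  have [||M GM leM] := IHb (N - U_(i))%MM => //.
    by move: leNb; rewrite -{1}(submK leU) mdegD mdeg1 addn1.
  exists M => //; apply/mnm_lepP => j; apply: leq_trans (mnm_lepP leM j) _.
  by rewrite mnmBE leq_subr.
have drop i : 0 < N i -> s - c < #|layer N (N i).-1| /\ Sdeg c N <= m.
  move=> Ni; have := small i; rewrite Ni /= -ltnNge; move: leN.
  have lt : (N i).-1 < height N by rewrite prednK // leq_height.
  pose x := #|layer N (N i).-1|.
  pose r := \sum_(k < height N | k != Ordinal lt) excess c N k.
  have -> : Sdeg c N = x - (s - c) + r.
    by rewrite (Sdeg_layers le_cs (leqnn _)) (bigD1 (Ordinal lt)).
  have -> : Sdeg c (N - U_(i))%MM = x - 1 - (s - c) + r.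
    rewrite (Sdeg_layers le_cs (le_h i)) (bigD1 (Ordinal lt)) //= excess_sub.
    rewrite prednK // eqxx; congr (_ + _); apply: eq_bigr => k ne.
    rewrite excess_sub ifN //.
    by apply: contraNneq ne => ek; apply/eqP/val_inj; rewrite /= -ek.
  rewrite -/x; move: x r => x r; lia.
exists N; last exact: lepm_refl.
apply/in_GP => //; split.
  apply/eqP; rewrite eqn_leq leN andbT.
  have [h0|h_gt0] := posnP (height N); first by rewrite (Sdeg_layers le_cs (leqnn _)) h0 big_ord0.
  by have [i ei] := height_attained h_gt0; case: (drop i); rewrite ?ei.
move=> k ltk; have [|i ei] := @height_attained N; first exact: leq_ltn_trans ltk.
have [|big _] := drop i; first by rewrite ei; apply: leq_ltn_trans ltk.
apply: leq_trans big _; apply/subset_leq_card/layer_sub; rewrite ei; lia.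
Qed.

Lemma exists_superset A r : #|A| <= r <= s -> exists2 B : {set 'I_s}, A \subset B & #|B| = r.
Proof.
case/andP=> leA ler; have [d] := ubnP (r - #|A|); elim: d A leA => // d IHd A leA lt.
have [e|ne] := eqVneq #|A| r; first by exists A.
have /card_gt0P[i] : 0 < #|~: A| by have := cardsC A; rewrite card_ord; lia.
rewrite inE => niA; have cA : #|i |: A| = #|A|.+1 by rewrite cardsU1 niA.
have [|| B sub cB] := IHd (i |: A); rewrite ?cA; try lia.
by exists B => //; apply: subset_trans sub; apply: subsetUr.
Qed.

(** Take for A a c-set containing the complement of the last layer of M, so that
    M has degree m in A.  Every N in G has degree >= m in A, with equality only if all layers of N contain the
    complement of A, and then N is determined by its exponents on A. *)
Lemma in_G_separated c m M : 0 < c < s -> 0 < m -> in_G c m M ->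
  exists2 A : {set 'I_s}, #|A| = c & forall N, in_G c m N -> N != M ->
    exists2 i, i \in A & M i < N i.
Proof.
case/andP=> c_gt0 lt_cs m_gt0 GM; have le_cs := ltnW lt_cs.
have [SM bigM] := in_GP _ _ le_cs GM.
have ht_gt0 N : in_G c m N -> 0 < height N.
  case/(in_GP _ _ le_cs) => SN _; rewrite lt0n; apply/eqP => h0; move: m_gt0.
  by rewrite -SN (Sdeg_layers le_cs (leqnn _)) h0 big_ord0.
have M_gt0 := ht_gt0 M GM; set t := height M in M_gt0.
pose E := layer M t.-1; have bigE : s - c < #|E| by apply: bigM; rewrite prednK.
have cE : #|~: E| <= c by have := cardsC E; rewrite card_ord; lia.
have [|A subA cA] := @exists_superset (~: E) c; first by rewrite cE.
have subAE : ~: A \subset E by rewrite subCset.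
have meets (C : {set 'I_s}) : s - c < #|C| -> exists2 i, i \in A & i \in C.
  move=> bigC; have /card_gt0P[i] : 0 < #|A :&: C|.
    have := cardsID A C; rewrite setIC; have := cardsC A; rewrite card_ord.
    by have := subset_leq_card (subsetIr C (~: A)); rewrite -setDE; lia.
  by rewrite inE => /andP[]; exists i.
exists A => // N GN ne; apply/exists_inP; apply: contraNT ne => /exists_inPn le_NM.
have {}le_NM i : i \in A -> N i <= M i by move/le_NM; rewrite -leqNgt.
have [SN bigN] := in_GP _ _ le_cs GN.
have sumM : \sum_(i in A) M i = m.
  rewrite -SM (Sdeg_layers le_cs (leqnn _)) (sum_layers A (leqnn _)).
  apply: eq_bigr => k _; rewrite (excess_eq cA) //; apply: subset_trans subAE _.
  by apply: layer_sub; have := ltn_ord k; rewrite -/t; lia.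
have sumN : \sum_(i in A) N i = m.
  apply/eqP; rewrite eqn_leq -{1}sumM leq_sum //= -SN; exact: Sdeg_le_sum.
have eq_A i : i \in A -> N i = M i.
  move=> iA; apply/eqP; rewrite eqn_leq le_NM //= leqNgt; apply/negP => lt.
  have : \sum_(i in A) N i < \sum_(i in A) M i.
    rewrite !(bigD1 i iA) /= -addSn leq_add // leq_sum // => j /andP[jA _].
    exact: le_NM.
  by rewrite sumM sumN ltnn.
have eq_out i : i \notin A -> N i = height N.
  move=> niA; apply/eqP; rewrite eqn_leq leq_height /=.
  have N_gt0 := ht_gt0 N GN; rewrite -{1}(prednK N_gt0) -in_layer.
  have lt : (height N).-1 < height N by rewrite prednK.
  apply: (subsetP (excess_eqP le_cs cA (bigN _ lt) _)); last by rewrite inE.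
  have : \sum_(k < height N) excess c N k = \sum_(k < height N) #|A :&: layer N k|.
    by rewrite -(Sdeg_layers le_cs (leqnn _)) -(sum_layers A (leqnn _)) SN sumN.
  rewrite (bigD1 (Ordinal lt)) //= [in RHS](bigD1 (Ordinal lt)) //= => eq_sum.
  have le_x := excess_le N (height N).-1 cA.
  have le_r : \sum_(k < height N | k != Ordinal lt) excess c N k <=
      \sum_(k < height N | k != Ordinal lt) #|A :&: layer N k|.
    by apply: leq_sum => k _; apply: excess_le.
  apply/eqP; rewrite eqn_leq le_x /=.
  by rewrite -(leq_add2r (\sum_(k < height N | k != Ordinal lt) excess c N k)) eq_sum leq_add2l.
have eq_h : height N = t.
  apply/eqP; rewrite eqn_leq; apply/andP; split.
    have N_gt0 := ht_gt0 N GN.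
    have [|i iA] := meets (layer N (height N).-1); first by apply: bigN; rewrite prednK.
    by rewrite inE prednK // => /leq_trans; apply; rewrite eq_A // leq_height.
  have [i iA] := meets E bigE; rewrite inE prednK // => /leq_trans; apply.
  by rewrite -eq_A // leq_height.
apply/eqP/mnmP => i; have [/eq_A//|niA] := boolP (i \in A).
rewrite eq_out // eq_h; apply/eqP; rewrite eqn_leq leq_height andbT.
have: i \in E by apply: (subsetP subAE); rewrite inE.
by rewrite inE prednK.
Qed.

End Layers.

(** * The orders alex and tau *)

Section FirstDifference.
Variables (T : eqType) (x0 : T) (r : rel T).
Implicit Types (u v w : seq T).

(** The common shape of the lexicographic comparison in alex and of >>_revlex. *)
Definition first_diff u v : Prop := exists j,
  [/\ j < size u, take j u = take j v & r (nth x0 u j) (nth x0 v j)].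

Lemma first_diff_nth u v j k : take j u = take j v -> k < j ->
  nth x0 u k = nth x0 v k.
Proof. by move=> e ltk; rewrite -(nth_take x0 ltk) e nth_take. Qed.

Lemma first_diff_irr u : irreflexive r -> ~ first_diff u u.
Proof. by move=> rI [j [_ _]]; rewrite rI. Qed.

Lemma take_le_eq (U : Type) (u v : seq U) i j : take j u = take j v -> i <= j ->
  take i u = take i v.
Proof. by move=> e leij; rewrite -(take_takel u leij) e take_takel. Qed.

Lemma first_diff_trans u v w : transitive r -> size u = size v ->
  first_diff u v -> first_diff v w -> first_diff u w.
Proof.
move=> rT sz [i [lti ei ri]] [j [ltj ej rj]].
case: (ltngtP i j) => [ltij|ltji|eij].
- exists i; split=> //; first by rewrite ei; apply: take_le_eq ej (ltnW ltij).
  by rewrite -(first_diff_nth ej ltij).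
- exists j; split; first by rewrite sz.
    by rewrite -ej; apply: take_le_eq ei (ltnW ltji).
  by rewrite (first_diff_nth ei ltji).
- move: ej rj; rewrite -eij => ej rj.
  by exists i; split=> //; [rewrite ei | apply: rT rj].
Qed.

Lemma first_diff_total u v :
  (forall x y, x != y -> r x y || r y x) -> size u = size v -> u != v ->
  first_diff u v \/ first_diff v u.
Proof.
move=> tot; elim: u v => [|x u IHu] [|y v] //= [sz].
rewrite eqseq_cons negb_and; have [<- /= ne|ne _] := eqVneq x y.
  case: (IHu v sz ne) => -[j [ltj ej rj]]; [left|right].
    by exists j.+1; split=> //=; rewrite ej.
  by exists j.+1; split=> //=; rewrite ej.
by case/orP: (tot x y ne) => rxy; [left|right]; exists 0; split.
Qed.

End FirstDifference.

Lemma lexi_first_diff (d b : seq nat) : size d = size b ->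
  ((b : seqlexi nat) < (d : seqlexi nat))%O <-> first_diff 0 gtn d b.
Proof.
elim: d b => [|x d IHd] [|y b] //=; first by move=> _; split=> // -[j []].
case=> sz; rewrite ltxi_cons; split.
  move=> /andP[leyx]; rewrite leEnat in leyx *.
  have [lexy /= lt|ltyx _] := leqP x y; last by exists 0.
  have [j [ltj ej rj]] := (IHd b sz).1 lt; exists j.+1; split=> //=.
  by congr (_ :: _) => //; apply/eqP; rewrite eqn_leq lexy leyx.
case=> -[|j] [/= ltj ej rj]; first by rewrite !leEnat (ltnW rj) leqNgt rj.
case: ej => -> ej; rewrite lexx /=; apply/(IHd b sz).2; by exists j.
Qed.

Lemma alexP (d b : seq nat) :
  alex d b <-> size d < size b \/ size d = size b /\ first_diff 0 gtn d b.
Proof.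
split=> [/orP[|/andP[/eqP sz lt]]|[lt|[sz fd]]].
- by left.
- by right; split=> //; apply/lexi_first_diff.
- by rewrite /alex lt.
- by rewrite /alex sz eqxx ltnn; apply/lexi_first_diff.
Qed.

(** A shorter b would miss the positive last entry of d, and if the lengths
    agree, the first entry where b is larger can only be the last one; both
    contradict the equality of the sums. *)
Lemma alex_dominated (d b : seq nat) : sumn b = sumn d ->
  all (leq 1) d -> (forall i, i < (size d).-1 -> nth 0 b i <= nth 0 d i) ->
  ~ alex b d.
Proof.
move=> eS pos le_bd /alexP[lt|[sz [j [ltj ej /= rj]]]].
  have szd : (size d).-1.+1 = size d by rewrite prednK //; apply: leq_ltn_trans lt.
  have led : size d <= (size d).-1.+1 by rewrite szd.
  have : sumn b < sumn d.
    rewrite (@sumn_nth b (size d).-1); last by rewrite -ltnS szd.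
    rewrite (sumn_nth led) big_ord_recr /= -addn1 leq_add //.
      by apply: leq_sum => i _; apply: le_bd.
    by apply: (allP pos); apply: mem_nth; rewrite szd.
  by rewrite eS ltnn.
have szd : (size d).-1.+1 = size d by rewrite prednK // -sz; apply: leq_ltn_trans ltj.
have led : size d <= (size d).-1.+1 by rewrite szd.
have leb : size b <= (size d).-1.+1 by rewrite sz.
have ej' : j = (size d).-1.
  apply/eqP; rewrite eqn_leq -ltnS szd -sz ltj /= leqNgt sz; apply/negP => /le_bd.
  by rewrite leqNgt rj.
have : sumn d < sumn b.
  rewrite (sumn_nth led) (sumn_nth leb) !big_ord_recr /= -addnS leq_add //.
    by apply: leq_sum => i _; rewrite (first_diff_nth 0 ej) // ej'.
  by rewrite -ej'.
by rewrite eS ltnn.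
Qed.

Lemma alex_irr d : ~ alex d d.
Proof.
by move/alexP => [|[_ /first_diff_irr]]; [rewrite ltnn | apply; apply: ltnn].
Qed.

Lemma alex_trans d b a : alex d b -> alex b a -> alex d a.
Proof.
move=> /alexP db /alexP ba; apply/alexP; case: db ba => [lt1|[sz1 f1]] [lt2|[sz2 f2]].
- by left; apply: ltn_trans lt2.
- by left; rewrite -sz2.
- by left; rewrite sz1.
- right; split; first by rewrite sz1.
  by apply: first_diff_trans sz1 f1 f2 => y x z /= lt1 lt2; apply: ltn_trans lt1.
Qed.

Lemma alex_total d b : d != b -> alex d b \/ alex b d.
Proof.
move=> ne; case: (ltngtP (size d) (size b)) => [lt|lt|sz].
- by left; apply/alexP; left.
- by right; apply/alexP; left.
- have gtn_total x y : x != y -> gtn x y || gtn y x by rewrite neq_ltn orbC.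
  have [f|f] := first_diff_total 0 gtn_total sz ne.
  + by left; apply/alexP; right.
  + by right; apply/alexP; right.
Qed.

Section Tau.
Variables (s : nat).
Implicit Types (M N : 'X_{1..s}) (A B C : {set 'I_s}) (c m k : nat) (i j : 'I_s).

Lemma revlexP A B : reflect
  (exists2 i, i \in B :\: A & forall j, i < j -> (j \in A) = (j \in B)) (revlex A B).
Proof.
apply: (iffP existsP) => [[i /andP[iBA /forallP eq_i]]|[i iBA eq_i]]; exists i => //.
  by move=> j ltij; apply/eqP; apply: (implyP (eq_i j)).
by rewrite iBA; apply/forallP => j; apply/implyP => /eq_i->.
Qed.

Lemma revlex_irr : irreflexive (@revlex s).
Proof.
by move=> A; apply/negbTE/negP => /revlexP[i]; rewrite !inE; case: (i \in A).
Qed.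

Lemma revlex_trans : transitive (@revlex s).
Proof.
move=> B A C /revlexP[i iBA eq_i] /revlexP[j jCB eq_j]; apply/revlexP.
move: iBA jCB; rewrite !inE => /andP[niA iB] /andP[njB jC].
case: (ltngtP i j) => [lt|lt|/val_inj eij].
- exists j; first by rewrite inE jC eq_i // njB.
  by move=> l ltl; rewrite -eq_j // eq_i //; apply: ltn_trans ltl.
- exists i; first by rewrite inE niA -eq_j.
  by move=> l ltl; rewrite -eq_j ?eq_i //; apply: ltn_trans ltl.
- by move: njB; rewrite -eij iB.
Qed.

Lemma revlex_total A B : A != B -> revlex A B || revlex B A.
Proof.
move=> ne; pose X := (A :\: B) :|: (B :\: A).
have [i0 i0X] : exists i0, i0 \in X.
  apply/set0Pn; apply: contraNneq ne => X0; apply/eqP/setP => i.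
  by move/setP/(_ i): X0; rewrite !inE; case: (i \in A) (i \in B) => [] [].
case: (@arg_maxnP _ i0 (mem X) (fun i => nat_of_ord i) i0X) => i iX max_i.
have eq_i j : i < j -> (j \in A) = (j \in B).
  move=> lt; have njX : j \notin X.
    by apply: contraL lt => /max_i; rewrite -leqNgt.
  by move: njX; rewrite !inE; case: (j \in A) (j \in B) => [] [].
case/setUP: iX => iX; apply/orP; [right|left]; apply/revlexP; exists i => // j /eq_i->//.
Qed.

Lemma part_size c M N : part c M = part c N -> size (nform M) = size (nform N).
Proof. by move/(congr1 size); rewrite !size_part !size_nform. Qed.

Lemma tau_irr c M : ~ tau c M M.
Proof. by case=> [/alex_irr|[_ /first_diff_irr]]; [|apply; apply: revlex_irr]. Qed.

Lemma tau_trans c M N N' : tau c M N -> tau c N N' -> tau c M N'.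
Proof.
case=> [a1|[e1 g1]] [a2|[e2 g2]].
- by left; apply: alex_trans a2.
- by left; rewrite -e2.
- by left; rewrite e1.
- right; split; first by rewrite e1.
  exact: first_diff_trans revlex_trans (part_size e1) g1 g2.
Qed.

Lemma tau_total c M N : M != N -> tau c M N \/ tau c N M.
Proof.
move=> ne; have [e|/(@alex_total _ _)[]] := eqVneq (part c M) (part c N); last 2 first.
- by left; left.
- by right; left.
have ne' : nform M != nform N.
  apply: contraNneq ne => eN; apply/eqP/layer_inj => k.
  by rewrite -!nth_nform eN.
by case: (first_diff_total set0 revlex_total (part_size e) ne'); [left|right]; right.
Qed.

Lemma tau_insert c M (G : seq 'X_{1..s}) : M \notin G -> tau_decreasing c G ->
  exists2 G', tau_decreasing c G' & perm_eq G' (M :: G).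
Proof.
elim: G => [|N G IHG]; first by exists [:: M] => //=; split.
rewrite inE negb_or => /andP[ne MG] /= [tauN dG].
have [tauMN|tauNM] := @tau_total c M N ne.
  exists [:: M, N & G] => //=; split=> // N'; rewrite inE => /predU1P[->//|/tauN].
  exact: tau_trans.
have [G' dG' pG'] := IHG MG dG; exists (N :: G').
  split=> // N'; rewrite (perm_mem pG') inE => /predU1P[->//|]; exact: tauN.
rewrite perm_sym; apply: (@perm_trans _ (N :: M :: G)).
  by rewrite -(cat1s M) -(cat1s N (M :: G)) -(cat1s M G) -(cat1s N G) perm_catCA.
by rewrite perm_cons perm_sym.
Qed.

Lemma tau_sort c (l : seq 'X_{1..s}) : uniq l ->
  exists2 G, tau_decreasing c G & perm_eq G l.
Proof.
elim: l => [|M l IHl] /=; first by exists [::].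
case/andP=> Ml /IHl[G dG pG].
have [|G' dG' pG'] := @tau_insert c M G _ dG; first by rewrite (perm_mem pG).
by exists G' => //; apply: perm_trans pG' _; rewrite perm_cons.
Qed.

Lemma in_G_finite c m : c < s -> exists2 l : seq 'X_{1..s}, uniq l & l =i in_G c m.
Proof.
move=> lt_cs; have le_cs := ltnW lt_cs.
exists [seq bmnm b | b <- enum {: 'X_{1..s < (s * m).+1}} & in_G c m (bmnm b)].
  rewrite map_inj_uniq; first exact/filter_uniq/enum_uniq.
  by move=> x y e; apply: val_inj.
move=> M; rewrite -topredE /=; apply/mapP/idP => [[N + ->]|GM].
  by rewrite mem_filter => /andP[].
have ltM : mdeg M < (s * m).+1.
  rewrite ltnS mdegE (@leq_trans (\sum_(i < s) m)) //; last by rewrite sum_nat_const card_ord.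
  apply: leq_sum => i _; apply: leq_trans (leq_height M i) _.
  have [<- _] := in_GP _ _ le_cs GM; rewrite (Sdeg_layers le_cs (leqnn _)).
  rewrite -[X in X <= _]card_ord -sum1_card leq_sum // => k _.
  by have [] := in_G_excess le_cs GM (ltn_ord k).
by exists (BMultinom ltM) => //; rewrite mem_filter mem_enum andbT; apply: GM.
Qed.

(** * The colon sets *)

Section LinearQuotients.
Variables (c m : nat) (M : 'X_{1..s}).
Hypotheses (lt_cs : c < s) (m_gt0 : 0 < m) (GM : in_G c m M).

Let le_cs : c <= s := ltnW lt_cs.

(** With t the height of M, the layers number t - 1 and t are
    {i | M_i >= t - 1} and {i | M_i = t}; the first of them is by convention
    the set of all indices if t = 1.  The indices in the colon ideal of M are
    those outside the layer t - 1, and those of this layer that lie outside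
    the last one but before its last element. *)
Definition colon_set : {set 'I_s} :=
  [set j | (M j < (height M).-1) ||
     (M j == (height M).-1) && [exists e, (height M <= M e) && (j < e)]].

Lemma in_G_height_gt0 : 0 < height M.
Proof.
have [SM _] := in_GP _ _ le_cs GM; rewrite lt0n; apply/eqP => h0.
by move: m_gt0; rewrite -SM (Sdeg_layers le_cs (leqnn _)) h0 big_ord0.
Qed.

Lemma colon_set_sub : colon_set \subset ~: layer M (height M).-1.
Proof.
apply/subsetP => j; rewrite !inE -leqNgt.
by case/orP => [/ltnW//|/andP[/eqP->]].
Qed.

(** If no exponent of N on the colon set exceeded that of M, the first t - 1
    layers of N would be contained in those of M; this forces P(N) = P(M),
    equality of these layers, and a last layer of N that is not
    revlex-larger than that of M. *)
Lemma tau_colon_set N : in_G c m N -> tau c N M ->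
  exists2 j, j \in colon_set & M j < N j.
Proof.
move=> GN tauNM; apply/exists_inP; apply: contraT => /exists_inPn le_NM; exfalso.
have {}le_NM j : j \in colon_set -> N j <= M j by move/le_NM; rewrite -leqNgt.
have t_gt0 := in_G_height_gt0; set t := height M in t_gt0.
have subNM k : k < t.-1 -> layer N k \subset layer M k.
  move=> ltk; apply/subsetP => i; rewrite !inE => ltN.
  have [ltM|] := ltnP (M i) t.-1; last exact: leq_trans.
  by apply: leq_trans ltN _; apply: le_NM; rewrite inE -/t ltM.
have [SM _] := in_GP _ _ le_cs GM; have [SN _] := in_GP _ _ le_cs GN.
have not_alex : ~ alex (part c N) (part c M).
  apply: alex_dominated; first by rewrite !sumn_part // SM SN.
    apply/(all_nthP 0) => k; rewrite size_part nth_part => ltk.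
    by have [] := in_G_excess le_cs GM ltk.
  move=> k; rewrite size_part !nth_part => ltk.
  by apply/leq_sub2r/subset_leq_card/subNM.
case: tauNM => [//|[eP [l [ltl el]]]]; rewrite !nth_nform.
have eh : height N = t by rewrite -(size_part c N) eP size_part.
have card_eq k : k < t -> #|layer N k| = #|layer M k|.
  move=> ltk; have [-> _] := in_G_excess le_cs GM ltk.
  have [|-> _] := in_G_excess le_cs GN (k := k); first by rewrite eh.
  by rewrite -!nth_part eP.
have eq_low k : k < t.-1 -> layer N k = layer M k.
  move=> ltk; apply/eqP; rewrite eqEcard subNM //= card_eq //.
  by rewrite (leq_trans ltk) // leq_pred.
rewrite size_nform eh in ltl.
case: (ltnP l t.-1) => [/eq_low->|lel]; first by rewrite revlex_irr.
have {lel ltl el} -> : l = t.-1 by lia.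
case/revlexP => e; rewrite inE => /andP[eN eM] eq_e.
have [j jN jM] : exists2 j, j \in layer N t.-1 & j \notin layer M t.-1.
  apply/subsetPn; apply: contra eN => sub.
  have /eqP-> // : layer N t.-1 == layer M t.-1.
  by rewrite eqEcard sub card_eq ?leqnn ?ltn_predL.
have ltje : j < e.
  rewrite ltnNge leq_eqVlt; apply/norP; split.
    by apply: contraNneq jM => /val_inj<-.
  by apply/negP => /eq_e; rewrite jN (negPf jM).
have jge : t.-1 <= M j.
  have [t1|t1] := posnP t.-1; first by rewrite t1.
  rewrite -(prednK t1) -in_layer -eq_low; last by rewrite prednK.
  by apply: (subsetP (layer_sub N (leq_pred t.-1))).
have ej : M j = t.-1.
  by apply/eqP; rewrite eqn_leq jge andbT leqNgt -in_layer.
have /le_NM : j \in colon_set.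
  rewrite inE -/t ej eqxx ltnn /=; apply/existsP; exists e.
  by move: eM; rewrite inE prednK // => ->.
by rewrite leqNgt ej -in_layer jN.
Qed.

(** A form outside the layer t - 1 enlarges a layer before the last, which is
    paid for by one element of the last layer (or by this layer as a whole, if
    its excess is 1); a form of the layer t - 1 replaces the last element of
    the last layer. *)
Lemma colon_set_tau j : j \in colon_set ->
  exists2 N, in_G c m N /\ tau c N M & (N <= M + U_(j))%MM.
Proof.
have t_gt0 := in_G_height_gt0; pose t' := (height M).-1.
have et : height M = t'.+1 by rewrite prednK.
have [SM bigM] := in_GP _ _ le_cs GM; pose E := layer M t'.
have bigE : s - c < #|E| by apply: bigM; rewrite et.
have inE_E i : (i \in E) = (M i == t'.+1).
  by rewrite inE eqn_leq -et leq_height et.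
(* N X is F_j M with one copy of every form of X removed, for X inside the last
   layer E. *)
pose N (X : {set 'I_s}) := [multinom M i + (i == j) - (i \in X) | i < s].
have leN X : (N X <= M + U_(j))%MM.
  by apply/mnm_lepP => i; rewrite mnmDE mnm1E mnmE eq_sym leq_subr.
have NX (X : {set 'I_s}) i : i \in X -> X \subset E -> j \notin E -> N X i = t'.
  move=> iX /subsetP sXE njE; have iE := sXE i iX; rewrite mnmE iX.
  have /negPf-> : i != j by apply: contraNneq njE => <-.
  by move: iE; rewrite inE_E => /eqP->; lia.
have Nj (X : {set 'I_s}) : X \subset E -> j \notin E -> N X j = (M j).+1.
  move=> /subsetP sXE njE; rewrite mnmE eqxx; have /negPf-> : j \notin X.
    by apply: contra njE; apply: sXE.
  by lia.
have No (X : {set 'I_s}) i : i \notin X -> i != j -> N X i = M i.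
  by move=> /negPf niX /negPf nij; rewrite mnmE niX nij; lia.
have height_N (X : {set 'I_s}) : X \subset E -> j \notin E -> M j <= t' ->
    height (N X) <= t'.+1.
  move=> sXE njE lej; apply/bigmax_leqP => i _.
  have [iX|niX] := boolP (i \in X); first by rewrite NX.
  have [->|nij] := eqVneq i j; first by rewrite Nj.
  by rewrite No // -et leq_height.
have layer_low (X : {set 'I_s}) k : X \subset E -> j \notin E -> k < t' ->
    layer (N X) k = (if k == M j then j |: layer M k else layer M k).
  move=> sXE njE ltk; apply/setP => i; rewrite in_layer.
  have [iX|niX] := boolP (i \in X).
    have := subsetP sXE i iX; rewrite inE_E NX // ltk => /eqP Mi.
    by case: eqP => _; rewrite !inE Mi ltnW ?orbT.
  have [->|nij] := eqVneq i j.
    rewrite Nj //; case: eqP => [->|ne]; first by rewrite !inE eqxx ltnSn.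
    by rewrite in_layer ltnS leq_eqVlt; case: eqP.
  by rewrite No //; case: eqP => _; rewrite !inE ?(negPf nij).
have layer_top (X : {set 'I_s}) : X \subset E -> j \notin E ->
    layer (N X) t' = (if M j == t' then j |: (E :\: X) else E :\: X).
  move=> sXE njE; apply/setP => i; rewrite in_layer.
  have [iX|niX] := boolP (i \in X).
    rewrite NX // ltnn; case: eqP => _; rewrite !inE iX ?orbF //.
    by apply/esym/negbTE; apply: contraNneq njE => <-; apply: (subsetP sXE).
  have [->|nij] := eqVneq i j.
    rewrite Nj // ltnS; have: M j <= t' by rewrite leqNgt -in_layer.
    rewrite leq_eqVlt => /orP[/eqP->|lt]; first by rewrite leqnn eqxx !inE eqxx.
    by rewrite leqNgt lt ltn_eqF // in_setD (negPf njE) andbF.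
  by rewrite No //; case: eqP => _; rewrite !inE ?(negPf nij) /= ?niX.
have attained k N' : k < height N' -> layer N' k != set0.
  move=> ltk; have [|i ei] := @height_attained s N'; first exact: leq_ltn_trans ltk.
  by apply/set0Pn; exists i; rewrite in_layer ei.
have take_eq u (d b : seq nat) : u <= size d -> u <= size b ->
    (forall k, k < u -> nth 0 d k = nth 0 b k) -> take u d = take u b.
  move=> led leb eq_nth; apply: (@eq_from_nth _ 0); rewrite !size_takel // => k ltk.
  by rewrite !nth_take // eq_nth.
have sumM : \sum_(k < t') excess c M k + excess c M t' = m.
  by rewrite -SM (Sdeg_layers le_cs (leqnn _)) et big_ord_recr.
rewrite inE -/t' => /orP[ltj|/andP[/eqP ej /existsP[e0 /andP[e0E lt_e0]]]].
  have njE : j \notin E by rewrite in_layer -leqNgt ltnW.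
  have [e] := height_attained t_gt0; rewrite et => ee.
  have eE : e \in E by rewrite inE_E ee.
  (* A last layer of excess 1 is used up as a whole: with one element less it
     would be too small for G. *)
  pose X := if excess c M t' == 1 then E else [set e].
  have sXE : X \subset E by rewrite /X; case: eqP => // _; rewrite sub1set.
  have hN : height (N X) <= t'.+1 by apply: height_N => //; apply: ltnW.
  have top : layer (N X) t' = E :\: X by rewrite layer_top // ltn_eqF.
  have cE : 0 < excess c M t' by have [] := in_G_excess le_cs GM (k := t') _; rewrite ?et.
  have card_top : #|E :\: X| = if excess c M t' == 1 then 0 else #|E|.-1.
    rewrite /X; case: eqP => _; first by rewrite setDv cards0.
    by rewrite (cardsD1 e E) eE.
  have excess_top : excess c (N X) t' + 1 = excess c M t'.
    rewrite {1}/excess top card_top; case: eqP => [->|ne]; first by rewrite sub0n.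
    by move: cE ne; rewrite /excess -/E; lia.
  have excess_low k : k < t' -> excess c (N X) k = excess c M k + (k == M j).
    move=> ltk; rewrite /excess layer_low //; case: eqP => [ek|_]; last by rewrite addn0.
    have := bigM k; rewrite et ltnW // => /(_ isT) bigk.
    by rewrite cardsU1 in_layer -ek ltnn add1n subSn ?addn1 // ltnW.
  exists (N X) => //; split.
    apply/in_GP => //; split.
      rewrite (Sdeg_layers le_cs hN) big_ord_recr /= -sumM -excess_top.
      under eq_bigr => k _ do rewrite excess_low //.
      rewrite big_split /= -addnA; congr (_ + _); rewrite addnC; congr (_ + _).
      rewrite (bigD1 (Ordinal ltj)) //= eqxx big1 // => k ne.
      by apply/eqP; rewrite eqb0; apply: contraNneq ne => ek; apply/eqP/val_inj.
    move=> k ltk; have := leq_trans ltk hN; rewrite ltnS leq_eqVlt => /orP[/eqP ek|ltk'].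
      move: (attained _ _ ltk); rewrite ek top -card_gt0 card_top.
      by case: eqP => // ne; move: cE ne; rewrite /excess -/E; lia.
    apply: leq_trans (bigM k _) _; first by rewrite et ltnW.
    by rewrite layer_low //; case: eqP => _ //; apply/subset_leq_card/subsetUr.
  left; apply/alexP; rewrite !size_part et.
  have [e1|ne1] := eqVneq (excess c M t') 1.
    left; rewrite ltn_neqAle hN andbT; apply/negP => /eqP eh.
    have /attained : t' < height (N X) by rewrite eh.
    by rewrite top -card_gt0 card_top e1.
  have eh : height (N X) = t'.+1.
    apply/eqP; rewrite eqn_leq hN /= ltnNge; apply/negP => /layer_height L0.
    by move: ne1; rewrite -excess_top /excess L0 cards0.
  right; split=> //; exists (M j); split.
  - by rewrite size_part eh ltnW.
  - apply: take_eq; rewrite ?size_part ?eh ?et; [exact: ltnW (ltnW _)..|].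
    move=> k ltk; rewrite !nth_part excess_low; last exact: ltn_trans ltj.
    by rewrite ltn_eqF // addn0.
  - by rewrite /= !nth_part excess_low // eqxx addn1.
have njE : j \notin E by rewrite in_layer ej ltnn.
have {e0E} e0E : e0 \in E by rewrite in_layer -et.
case: (@arg_maxnP _ e0 (mem E) (fun i => nat_of_ord i) e0E) => e eE max_e.
have {}eE : e \in E := eE.
have ltje : j < e by apply: leq_trans lt_e0 (max_e _ e0E).
have sXE : [set e] \subset E by rewrite sub1set.
have hN : height (N [set e]) <= t'.+1 by apply: height_N; rewrite ?ej.
have top : layer (N [set e]) t' = j |: (E :\ e) by rewrite layer_top // ej eqxx.
have low k : k < t' -> layer (N [set e]) k = layer M k.
  move=> ltk; rewrite layer_low // ej ltn_eqF //.
have card_top : #|layer (N [set e]) t'| = #|E|.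
  by rewrite top cardsU1 in_setD1 (negPf njE) andbF (cardsD1 e E) eE.
have eh : height (N [set e]) = t'.+1.
  apply/eqP; rewrite eqn_leq hN /= ltnNge; apply/negP => /layer_height L0.
  by move: card_top bigE; rewrite L0 cards0 => <-.
have excess_eq k : k <= t' -> excess c (N [set e]) k = excess c M k.
  by rewrite leq_eqVlt /excess => /orP[/eqP->|/low->//]; rewrite card_top.
exists (N [set e]) => //; split.
  apply/in_GP => //; split.
    rewrite (Sdeg_layers le_cs hN) big_ord_recr /= -sumM excess_eq //.
    by congr (_ + _); apply: eq_bigr => k _; rewrite excess_eq // ltnW.
  move=> k; rewrite eh ltnS leq_eqVlt => /orP[/eqP->|ltk]; first by rewrite card_top.
  by rewrite low //; apply: bigM; rewrite et ltnW.
right; split.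
  apply: (@eq_from_nth _ 0); rewrite !size_part eh // => k ltk.
  by rewrite !nth_part excess_eq.
exists t'; split; first by rewrite size_nform eh.
  apply: (@eq_from_nth _ set0); rewrite !size_takel ?size_nform ?eh ?et // => k ltk.
  by rewrite !nth_take // !nth_nform low.
rewrite !nth_nform top; apply/revlexP; exists e.
  rewrite in_setD eE andbT in_setU1 in_setD1 eqxx orbF.
  by apply: contraTneq ltje => ->; rewrite ltnn.
move=> l ltl; rewrite in_setU1 in_setD1.
have /negPf-> : l != j by apply: contraTneq ltl => ->; rewrite -leqNgt ltnW.
by have /negPf-> : l != e by apply: contraTneq ltl => ->; rewrite ltnn.
Qed.

End LinearQuotients.
End Tau.

(** * Counting the colon set *)

Section EnumVal.
Variable s : nat.
Implicit Types (A B : {set 'I_s}).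

Lemma enum_val_lt B (i j : 'I_#|B|) : i < j -> enum_val i < enum_val j.
Proof.
move=> lt; have x0 := enum_val i; rewrite !(enum_val_nth x0).
have sorted_B : sorted (relpre val ltn) (enum B).
  rewrite -sorted_map; have -> : enum B = [seq x <- enum 'I_s | x \in B].
    by rewrite {1}/enum_mem -enumT.
  rewrite sorted_map; apply: sorted_filter; first by move=> y x z; apply: ltn_trans.
  by rewrite -sorted_map val_enum_ord iota_ltn_sorted.
have tr : transitive (relpre (val : 'I_s -> nat) ltn) by move=> y x z; apply: ltn_trans.
by apply: (sorted_ltn_nth tr x0 sorted_B); rewrite ?inE -?cardE.
Qed.

Lemma enum_val_le B (i j : 'I_#|B|) : (enum_val i <= enum_val j) = (i <= j).
Proof.
case: (ltngtP i j) => [lt|lt|/val_inj->]; last exact: leqnn.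
  exact/ltnW/enum_val_lt.
by apply/negbTE; rewrite -ltnNge; apply: enum_val_lt.
Qed.

Lemma card_below_enum_val B (j : 'I_#|B|) : #|[set y in B | y <= enum_val j]| = j.+1.
Proof.
have -> : [set y in B | y <= enum_val j] = [set enum_val i | i in [set i : 'I_#|B| | i <= j]].
  apply/setP => y; rewrite inE; apply/andP/imsetP => [[yB ley]|[i]].
    exists (enum_rank_in yB y); last by rewrite enum_rankK_in.
    by rewrite inE -enum_val_le enum_rankK_in.
  by rewrite inE => lei ->; rewrite enum_val_le enum_valP.
rewrite card_imset; last exact: enum_val_inj.
rewrite cardsE -sum1_card (eq_bigl (fun i : 'I_#|B| => i < j.+1)) //.
by rewrite (big_ord_narrow (ltn_ord j)) sum1_card card_ord.
Qed.

(** The enumeration of B is increasing, so the position of an element of B is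
    the number of elements of B that do not exceed it. *)
Lemma mfunE B A : A \subset B ->
  mfun B A = #|[set y in B | [exists e in A, y <= e]]|.
Proof.
move=> /subsetP sAB; apply/eqP; rewrite eqn_leq; apply/andP; split.
  apply/bigmax_leqP => j jA; rewrite -card_below_enum_val subset_leq_card //.
  apply/subsetP => y; rewrite !inE => /andP[-> ley]; apply/exists_inP.
  by exists (enum_val j).
have [e0 e0A|A0] := pickP (mem A); last first.
  rewrite eq_card0 // => y; rewrite !inE; apply/negbTE/negP => /andP[_ /exists_inP[e eA]].
  by have := A0 e; rewrite /= eA.
case: (@arg_maxnP _ e0 (mem A) (fun i => nat_of_ord i) e0A) => e eA max_e.
have eB := sAB e eA; pose j := enum_rank_in eB e.
have ej : enum_val j = e by rewrite enum_rankK_in.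
apply: (@leq_trans j.+1); last first.
  by rewrite /mfun (bigD1 j) ?ej //= leq_maxl.
rewrite -card_below_enum_val ej subset_leq_card //; apply/subsetP => y.
rewrite !inE => /andP[-> /exists_inP[e' e'A ley]]; apply: leq_trans ley _.
exact: max_e.
Qed.

End EnumVal.

Lemma alex_raise c m (u v : seq nat) (p x : nat) :
  is_partition c m (u ++ p :: rcons v x) -> all (ltn p) u -> p < c ->
  exists b, [/\ is_partition c m b, alex b (u ++ p :: rcons v x)
    & take (size u) (u ++ p :: rcons v x) = take (size u) b].
Proof.
move=> par up ltpc; pose w := if x == 1 then [::] else [:: x.-1].
have tr : transitive geq by move=> y x' z /= lexy lezy; apply: leq_trans lezy lexy.
case/and3P: par => /eqP sumd sortd alld; move: sumd sortd alld.
rewrite -cats1 !sumn_cat /= sumn_cat /= (sorted_pairwise tr) pairwise_cat /=.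
rewrite all_cat /= !all_cat pairwise_cat /= allrel1r !andbT.
move=> sumd /and3P[_ sort_u /andP[/andP[ge_pv ge_px] /andP[ge_vx sort_v]]].
rewrite all_cat /= andbT => /and4P[all_u /andP[p_gt0 _] all_v /andP[x_gt0 le_xc]].
exists (u ++ p.+1 :: v ++ w).
have memw y : y \in w -> [/\ 0 < y, y < x & x != 1].
  rewrite /w; case: eqP => // /eqP x1; rewrite inE => /eqP->; split=> //; lia.
have sumw : sumn w = x.-1 by rewrite /w; case: eqP => [->//|_] /=; rewrite addn0.
split; last by rewrite !take_size_cat.
  apply/and3P; split.
  - by rewrite sumn_cat /= sumn_cat sumw -sumd; apply/eqP; lia.
  - rewrite (sorted_pairwise tr) pairwise_cat sort_u /=; apply/and3P; split.
    + apply/allrelP => y z yu; have := allP up y yu => /= ltpy.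
      rewrite inE mem_cat => /predU1P[->//|/orP[zv|/memw[_ ltzx _]]].
        by apply: leq_trans (allP ge_pv z zv) (ltnW ltpy).
      by apply: leq_trans (ltnW ltzx) (leq_trans ge_px (ltnW ltpy)).
    + rewrite all_cat; apply/andP; split; apply/allP => z.
        by move/(allP ge_pv) => /= /leqW.
      by move/memw => [_ ltzx _] /=; apply/leqW/(leq_trans (ltnW ltzx)).
    + rewrite pairwise_cat sort_v /=; apply/andP; split.
        apply/allrelP => y z yv /memw[_ ltzx _] /=.
        by apply: leq_trans (ltnW ltzx) (allP ge_vx y yv).
      by rewrite /w; case: eqP.
  - rewrite all_cat all_u /= ltpc all_cat all_v; apply/allP => z /memw[z_gt0 ltzx _].
    by rewrite z_gt0 (leq_trans (ltnW ltzx)).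
apply/alexP; rewrite !size_cat /= !size_cat /=.
have [x1|nx1] := eqVneq x 1; first by left; rewrite /w x1 /=; lia.
right; split; first by rewrite /w (negPf nx1).
exists (size u); split.
- by rewrite size_cat /=; lia.
- by rewrite !take_size_cat.
- by rewrite /= !nth_cat ltnn subnn /=.
Qed.

Lemma division_unique c q r q' r' : q * c + r = q' * c + r' ->
  1 <= r <= c -> 1 <= r' <= c -> q = q'.
Proof.
wlog ltq : q r q' r' / q <= q' => [wl e hr hr'|].
  by case: (leqP q q') => [|/ltnW] le; [apply: (wl q r q' r') | apply/esym; apply: (wl q' r' q r)].
rewrite leq_eqVlt in ltq; case/orP: ltq => [/eqP//|lt] e hr hr'.
have : q.+1 * c <= q' * c by rewrite leq_mul2r lt orbT.
by rewrite mulSn; lia.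
Qed.

Section CardColonSet.
Variables (s c m : nat) (M : 'X_{1..s}).
Hypotheses (lt_cs : c < s) (m_gt0 : 0 < m) (GM : in_G c m M).
Let le_cs : c <= s := ltnW lt_cs.
Let t_gt0 : 0 < height M := in_G_height_gt0 lt_cs m_gt0 GM.

(** The last but one layer, or everything if there is only one layer. *)
Definition penultimate : {set 'I_s} := [set i | (height M).-1 <= M i].

Notation last_layer := (layer M (height M).-1).

Lemma penultimate_layer : 1 < height M -> penultimate = layer M (height M).-2.
Proof.
by move=> gt1; apply/setP => i; rewrite !inE; case: (height M) gt1 => [|[|t]].
Qed.

Lemma last_layer_sub : last_layer \subset penultimate.
Proof. by apply/subsetP => i; rewrite !inE; apply: ltnW. Qed.

(** With D the penultimate and E the last layer, the colon set is the complement
    of D together with the elements of D up to the last element of E that are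
    not in E. *)
Lemma card_colon_set :
  #|colon_set M| + #|penultimate| + #|last_layer| = s + mfun penultimate last_layer.
Proof.
pose X := [set y in penultimate | [exists e in last_layer, y <= e]].
have -> : mfun penultimate last_layer = #|X| by apply: mfunE last_layer_sub.
have eX : X :&: last_layer = last_layer.
  apply/setIidPr/subsetP => y yE; rewrite inE (subsetP last_layer_sub) //=.
  by apply/exists_inP; exists y.
have eC : colon_set M = ~: penultimate :|: (X :\: last_layer).
  apply/setP => j; rewrite !inE -ltnNge; congr (_ || _).
  apply/andP/andP => [[/eqP ej /existsP[e /andP[le_e lt_e]]]|].
    rewrite -leqNgt ej leqnn; split=> //; apply/exists_inP; exists e; last exact: ltnW.
    by rewrite inE prednK.
  move=> [nE /andP[le_j /exists_inP[e eE le_e]]]; split.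
    by rewrite eqn_leq le_j andbT leqNgt.
  apply/existsP; exists e; apply/andP; split; first by move: eE; rewrite inE prednK.
  rewrite ltn_neqAle le_e andbT; apply: contraNneq nE => /val_inj->.
  by move: eE; rewrite inE.
have := cardsC penultimate; rewrite card_ord.
have := cardsID last_layer X; rewrite eX.
have := cardsU (~: penultimate) (X :\: last_layer); rewrite -eC.
have -> : ~: penultimate :&: (X :\: last_layer) = set0.
  by apply/setP => j; rewrite !inE -ltnNge; case: ltnP => //= _; rewrite andbF.
by rewrite cards0 subn0 => ->; lia.
Qed.

Lemma excess_mono k l : k <= l -> excess c M l <= excess c M k.
Proof. by move=> lekl; apply/leq_sub2r/subset_leq_card/layer_sub. Qed.

Lemma excess_le_c k : excess c M k <= c.
Proof.
rewrite /excess leq_subLR subnK //.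
by apply: leq_trans (max_card _) _; rewrite card_ord.
Qed.

Lemma part_is_partition : is_partition c m (part c M).
Proof.
have [SM _] := in_GP _ _ le_cs GM.
apply/and3P; split; first by rewrite sumn_part // SM.
  apply/(sortedP 0) => i _ /=; rewrite !nth_part; exact: excess_mono.
apply/(all_nthP 0) => k; rewrite size_part nth_part excess_le_c andbT => ltk.
by have [] := in_G_excess le_cs GM ltk.
Qed.

Lemma layer_excess k l : k < height M -> l < height M ->
  excess c M k = excess c M l -> layer M k = layer M l.
Proof.
wlog lekl : k l / k <= l => [wl ltk ltl e|].
  by case: (leqP k l) => [|/ltnW] le; [apply: wl | apply/esym; apply: wl].
move=> ltk ltl e; apply/esym/eqP; rewrite eqEcard layer_sub //=.
have [ek _] := in_G_excess le_cs GM ltk; have [el _] := in_G_excess le_cs GM ltl.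
by rewrite ek el e.
Qed.

Lemma factor_excess k : k < height M -> factor c M (excess c M k) = layer M k.
Proof.
move=> ltk; rewrite /factor nth_nform; apply: layer_excess => //.
  by rewrite -(size_part c) index_mem -nth_part mem_nth ?size_part.
by rewrite -nth_part nth_index // -nth_part mem_nth ?size_part.
Qed.

Lemma last_part : last 0 (part c M) = excess c M (height M).-1.
Proof. by rewrite -nth_last size_part nth_part. Qed.

Section NotMaximal.
Variables (q r : nat).
Hypotheses (em : m = q * c + r) (hr : 1 <= r <= c).
Hypothesis ne_max : part c M <> rcons (nseq q c) r.

Let p := excess c M (height M).-2.

Lemma not_max_height : 1 < height M.
Proof.
rewrite ltnNge; apply/negP => let1; apply: ne_max.
have h1 : height M = 1 by apply/eqP; rewrite eqn_leq let1.
have [SM _] := in_GP _ _ le_cs GM.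
have e0 : excess c M 0 = m by rewrite -SM (Sdeg_layers le_cs (leqnn _)) h1 big_ord1.
have q0 : q = 0.
  apply: (@division_unique c q r 0 m) => //.
  by rewrite m_gt0 -e0 excess_le_c.
apply: (@eq_from_nth _ 0); first by rewrite size_part h1 q0.
rewrite size_part h1 q0 => -[|//] _; by rewrite nth_part e0 em q0.
Qed.

Lemma not_max_excess : p < c.
Proof.
have t_gt1 := not_max_height.
rewrite ltn_neqAle excess_le_c andbT; apply/eqP => pc; apply: ne_max.
have [SM _] := in_GP _ _ le_cs GM.
pose t' := (height M).-1; have et : height M = t'.+1 by rewrite prednK.
have exc k : k < t' -> excess c M k = c.
  move=> ltk; apply/eqP; rewrite eqn_leq excess_le_c -{1}pc excess_mono //.
  by rewrite /t' in ltk; lia.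
have em' : m = t' * c + excess c M t'.
  rewrite -SM (Sdeg_layers le_cs (leqnn _)) et big_ord_recr /=; congr (_ + _).
  under eq_bigr => k _ do rewrite exc //.
  by rewrite sum_nat_const card_ord.
have [_ ex_gt0] : #|layer M t'| = excess c M t' + (s - c) /\ 0 < excess c M t'.
  by apply: (in_G_excess le_cs GM); rewrite et.
have eq_q : q = t'.
  apply: (@division_unique c q r t' (excess c M t')); rewrite -?em -?em' //.
  by rewrite ex_gt0 excess_le_c.
have er : r = excess c M t' by move: em'; rewrite em eq_q => /addnI.
apply: (@eq_from_nth _ 0); first by rewrite size_part et size_rcons size_nseq eq_q.
rewrite size_part et => k; rewrite ltnS leq_eqVlt nth_part nth_rcons size_nseq eq_q.
case/orP => [/eqP->|ltk]; first by rewrite ltnn eqxx er.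
by rewrite ltk nth_nseq ltk exc.
Qed.

Let k0 := index p (part c M).

Lemma index_lt : k0 < (height M).-1.
Proof.
have t_gt1 := not_max_height.
have le2 : (height M).-2 < (height M).-1 by lia.
apply: index_ltn; rewrite /p -nth_part -(nth_take 0 le2) mem_nth //.
by rewrite size_takel ?size_part ?leq_pred.
Qed.

(** Lowering the last entry by one, and raising the first entry equal to the
    last but one, gives an alex-larger partition; no agreement beyond that
    entry is possible, as the entries after it would be dominated. *)
Lemma overlap_index : is_overlap_index c m (part c M) k0.+1.
Proof.
have t_gt1 := not_max_height; have ltk0 := index_lt.
have parM := part_is_partition; have ltp := not_max_excess.
have [sumM sortM allM] := and3P parM.
have pM : p \in part c M by rewrite /p -nth_part mem_nth // size_part; lia.
have ek0 : nth 0 (part c M) k0 = p by rewrite nth_index.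
split.
  split=> //=; pose u := take k0 (part c M); pose w := drop k0.+1 (part c M).
  have ed : part c M = u ++ p :: w.
    by rewrite -ek0 -drop_nth ?cat_take_drop // index_mem.
  have szu : size u = k0 by rewrite size_takel // index_size.
  have : 0 < size w by rewrite size_drop size_part; lia.
  case/lastP: w ed => // v x ed _.
  have [||b [parb alexb takeb]] := @alex_raise c m u v p x _ _ ltp.
  - by rewrite -ed.
  - apply/allP => y /= yu; have /nthP-/(_ 0)[i] := yu; rewrite szu => lti ey.
    rewrite ltn_neqAle; apply/andP; split.
      apply: contraTneq yu => <-; apply/negP => /index_ltn.
      by rewrite -/k0 ltnn.
    by rewrite -ey nth_take // nth_part /p excess_mono //; lia.
  by move: alexb takeb; rewrite szu -ed; exists b.
case=> // j' [_ [b [parb alexb eb]]]; rewrite ltnS leqNgt; apply/negP => /= ltj.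
rewrite /= in eb; case/and3P: parb => /eqP sumb sortb _.
apply: (alex_dominated _ _ _ alexb); first by rewrite sumb (eqP sumM).
  by apply: sub_all allM => y /andP[].
move=> i; rewrite size_part => lti; case: (ltnP i j') => [lt|le].
  by rewrite (first_diff_nth 0 eb lt).
apply: (@leq_trans p); last by rewrite nth_part /p excess_mono //; lia.
have ltij : k0 < i by apply: leq_trans ltj le.
rewrite -ek0 (first_diff_nth 0 eb ltj).
have [lt|le'] := ltnP i (size b); last by rewrite nth_default.
have tr : transitive geq by move=> y x z /= lexy lezy; apply: leq_trans lezy lexy.
by apply: (sorted_ltn_nth tr 0 sortb); rewrite ?inE //; apply: ltn_trans ltij lt.
Qed.

End NotMaximal.
End CardColonSet.

(** * Symbolic powers of the star ideal *)

Section SymbolicPower.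
Local Open Scope ring_scope.
Variables (R : comNzRingType) (s c : nat) (F : 'I_s -> R).
Hypothesis noeR : noetherian R.
Hypothesis regF : forall l : seq 'I_s, uniq l -> (size l <= c.+1)%N ->
  regular_seq [seq F i | i <- l].
Implicit Types (A B C : {set 'I_s}) (M N : 'X_{1..s}).

Notation form_ideal A := (ideal_of [seq F i | i in A]).
Notation star := (star_ideal F c).

Lemma mon_val_power_ideal A (a : 'I_s -> nat) N i : i \in A -> (a i <= N i)%N ->
  power_ideal F A a (mon_val F N).
Proof.
move=> iA le_aN; rewrite /mon_val (bigD1 i) //= -(subnK le_aN) exprD.
rewrite mulrAC; apply: is_idealMl; first exact: power_ideal_ideal.
exact: power_ideal_gen.
Qed.

Lemma form_nzd_mon A M x : (#|A| <= c)%N -> {in A, forall i, M i = 0%N} ->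
  form_ideal A (x * mon_val F M) -> form_ideal A x.
Proof.
move=> cA M0 xM; apply: (form_ideal_colon regF (M := M)) => //.
by apply/power_ideal1 => // i iA; rewrite M0.
Qed.

Definition cofactor A : R := mon_val F [multinom (i \notin A : nat) | i < s].

Lemma cofactor_nzd A x : #|A| = c -> form_ideal A (x * cofactor A) -> form_ideal A x.
Proof.
by move=> cA; apply: form_nzd_mon => [|i iA]; [rewrite cA | rewrite mnmE iA].
Qed.

(** Every c-set other than A contains an index outside A. *)
Lemma cofactor_star A x : #|A| = c -> form_ideal A x -> star (cofactor A * x).
Proof.
move=> cA xA B cB; have idB : is_ideal (form_ideal B) by apply: ideal_span_ideal.
have [eAB|ne] := eqVneq A B; first by apply: is_idealMl => //; rewrite -eAB.
have /subsetPn[i iB niA] : ~~ (B \subset A).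
  by apply: contra ne => sBA; rewrite eq_sym eqEcard sBA cA cB leqnn.
apply: is_idealMr => //; apply/(@power_ideal1 _ _ F B (fun=> 1%N)) => //.
by apply: (mon_val_power_ideal iB); rewrite mnmE niA.
Qed.

(** The associated primes of the ideal of A avoid the other forms, and so they
    are associated to the star ideal as well. *)
Lemma form_assoc_prime A y : #|A| = c -> prime_ideal (colon (form_ideal A) y) ->
  associated_prime star (colon (form_ideal A) y).
Proof.
move=> cA primeP; split=> //; exists (y * cofactor A) => z; rewrite /colon mulrA.
split=> [zy|zyv]; first by rewrite mulrC; apply: cofactor_star.
exact: cofactor_nzd (zyv A cA).
Qed.

(** The j-th power of the ideal (F_i : i in A), in terms of the monomials that
    it contains. *)
Definition weight_ideal A j : R -> Prop :=
  ideal_span (fun y => exists2 M : 'X_{1..s}, (j <= \sum_(i in A) M i)%N & y = mon_val F M).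

Lemma weight_ideal_ideal A j : is_ideal (weight_ideal A j).
Proof. exact: ideal_span_ideal. Qed.

Lemma weight_ideal_gen A j M : (j <= \sum_(i in A) M i)%N ->
  weight_ideal A j (mon_val F M).
Proof. by move=> leM; apply: ideal_span_gen; exists M. Qed.

Lemma weight_idealS A j x y : form_ideal A x -> weight_ideal A j y ->
  weight_ideal A j.+1 (x * y).
Proof.
move=> xA yA; have idW := weight_ideal_ideal A j.+1.
move: x xA; apply: (ideal_span_min (J := fun x => weight_ideal A j.+1 (x * y))).
  split.
  - by rewrite mul0r; apply: is_ideal0.
  - by move=> x x' Wx Wx'; rewrite mulrDl; apply: is_idealD.
  - by move=> a x Wx; rewrite -mulrA; apply: is_idealMl.
move=> _ /imageP[i iA ->]; move: y yA.
apply: (ideal_span_min (J := fun y => weight_ideal A j.+1 (F i * y))).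
  split.
  - by rewrite mulr0; apply: is_ideal0.
  - by move=> x x' Wx Wx'; rewrite mulrDr; apply: is_idealD.
  - by move=> a x Wx; rewrite mulrCA; apply: is_idealMl.
move=> _ [M leM ->]; rewrite -mon_valU -mon_valD; apply: weight_ideal_gen.
under eq_bigr do rewrite mnmDE mnm1E.
rewrite big_split /= (bigD1 i) //= eqxx -addnA add1n ltnS.
by apply: leq_trans leM _; apply: leq_addl.
Qed.

Lemma star_pow_weight A j x : #|A| = c -> ideal_pow star j x -> weight_ideal A j x.
Proof.
move=> cA; move: j x; apply: ideal_pow_min => [j|x|j x y xI yW].
- exact: weight_ideal_ideal.
- rewrite -[x]mulr1; apply: is_idealMl; first exact: weight_ideal_ideal.
  by rewrite -(mon_val0 F); apply: weight_ideal_gen.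
- by apply: weight_idealS => //; apply: xI.
Qed.

Lemma exists_submonomial A j M : (j <= \sum_(i in A) M i)%N ->
  exists N, [/\ (N <= M)%MM, mdeg N = j & forall i, i \notin A -> N i = 0%N].
Proof.
elim: j => [_|j IHj lt].
  exists 0%MM; split=> [||i _]; rewrite ?mdeg0 ?mnm0E //.
  by apply/mnm_lepP => i; rewrite mnm0E.
have [N [leN dN N0]] := IHj (ltnW lt).
have sumN : (\sum_(i in A) N i = j)%N.
  rewrite -dN mdegE [RHS](bigID (mem A)) /= [X in (_ + X)%N]big1 ?addn0 //.
have [i iA ltNi] : exists2 i, i \in A & (N i < M i)%N.
  apply/exists_inP; apply: contraLR lt => /exists_inPn le_MN.
  rewrite -leqNgt -sumN leq_sum // => i /le_MN; by rewrite -leqNgt.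
exists (N + U_(i))%MM; split=> [||l nlA].
- apply/mnm_lepP => l; rewrite mnmDE mnm1E; case: eqP => [<-|_]; first by rewrite addn1.
  by rewrite addn0; apply/mnm_lepP.
- by rewrite mdegD mdeg1 dN addn1.
- by rewrite mnmDE mnm1E N0 // (_ : (i == l) = false) //; apply: contraNF nlA => /eqP<-.
Qed.

(** Having exactly one coefficient for each monomial of degree j in A is what
    allows the coefficients to be treated one at a time. *)
Lemma weight_ideal_repr A j x : weight_ideal A j x ->
  exists a : 'X_{1..s < j.+1} -> R,
    x = \sum_(v : 'X_{1..s < j.+1} | (mdeg v == j) &&
           [forall i, (i \notin A) ==> (v i == 0)%N]) a v * mon_val F v.
Proof.
move: x; apply: ideal_span_min; first split.
- by exists (fun=> 0); rewrite big1 // => v _; rewrite mul0r.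
- move=> _ _ [a ->] [b ->]; exists (fun v => a v + b v).
  by rewrite -big_split; apply: eq_bigr => v _; rewrite mulrDl.
- move=> b _ [a ->]; exists (fun v => b * a v).
  by rewrite mulr_sumr; apply: eq_bigr => v _; rewrite mulrA.
move=> _ [M leM ->]; have [N [leN dN N0]] := exists_submonomial leM.
have ltN : (mdeg N < j.+1)%N by rewrite dN.
exists (fun v => if v == BMultinom ltN then mon_val F (M - N)%MM else 0).
rewrite (bigD1 (BMultinom ltN)) /=; last first.
  by rewrite dN eqxx; apply/forallP => i; apply/implyP => /N0->.
rewrite eqxx big1 ?addr0; first exact: mon_val_dvd.
by move=> v /andP[_ /negPf->]; rewrite mul0r.
Qed.

(** Induction on the weight.  If a coefficient a_v of x in weight j were not in
    (F_i : i in A), some prime P associated to this ideal would be the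
    annihilator of a multiple of a_v.  A multiplier u outside P moves x to
    weight j + 1; modulo (F_i^(v_i + 1) : i in A) only the term of v is left
    of u x, so that u a_v lies in (F_i : i in A), that is, u in P. *)
Lemma symbolic_power_weight A m x : #|A| = c -> symbolic_power star m x ->
  weight_ideal A m x.
Proof.
move=> cA xsym; have le_cA : (#|A| <= c)%N by rewrite cA.
have : (m <= m)%N by []; move: {1 3}m => j; elim: j => [|j IHj] ltj.
  rewrite -[x]mulr1; apply: is_idealMl; first exact: weight_ideal_ideal.
  by rewrite -(mon_val0 F); apply: weight_ideal_gen.
have /weight_ideal_repr[a ex] := IHj (ltnW ltj).
rewrite ex; apply: is_ideal_sum; first exact: weight_ideal_ideal.
move=> v Pv; have /andP[/eqP dv /forallP v0] := Pv.
have sum_v (w : 'X_{1..s < j.+1}) : (mdeg w == j) &&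
    [forall i, (i \notin A) ==> (w i == 0)%N] -> (\sum_(i in A) w i = j)%N.
  case/andP=> /eqP dw /forallP w0.
  rewrite -[RHS]dw mdegE [RHS](bigID (mem A)) /= [X in (_ + X)%N]big1 ?addn0 //.
  by move=> i niA; apply/eqP/(implyP (w0 i)).
apply: weight_idealS; last by apply: weight_ideal_gen; rewrite sum_v.
apply: NNPP => nav; have idA : is_ideal (form_ideal A) by apply: ideal_span_ideal.
have [b [primeP nab]] := exists_assoc_prime noeR idA nav.
have [u nPu uxI] := xsym _ (form_assoc_prime cA primeP); apply: nPu.
rewrite /colon mulrA; apply: is_idealMr => //.
apply: (form_ideal_colon regF (M := v)) => //.
have idP : is_ideal (power_ideal F A (fun i => (v i).+1)) by apply: power_ideal_ideal.
have : power_ideal F A (fun i => (v i).+1) (u * x).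
  move: (star_pow_weight cA uxI); apply: ideal_span_min => // _ [M leM ->].
  have /exists_inP[i iA lti] : [exists i in A, (v i < M i)%N].
    apply: contraLR (leq_trans ltj leM) => /exists_inPn le_Mv.
    rewrite -leqNgt -[X in (_ <= X)%N](sum_v v) // leq_sum // => i /le_Mv.
    by rewrite -leqNgt.
  exact: mon_val_power_ideal lti.
rewrite ex (bigD1 v) //= mulrDr => Pux.
have -> : u * a v * mon_val F v = u * (a v * mon_val F v) by rewrite mulrA.
set y := u * \sum_(_ | _) _ in Pux.
rewrite -[u * _](addrK y); apply: is_idealB => //.
rewrite /y mulr_sumr; apply: is_ideal_sum => // w /andP[Pw ne].
apply: is_idealMl => //; apply: is_idealMl => //.
have /exists_inP[i iA lti] : [exists i in A, (v i < w i)%N].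
  apply: contraNT ne => /exists_inPn le_wv.
  have {}le_wv i : i \in A -> (w i <= v i)%N by move/le_wv; rewrite -leqNgt.
  apply/eqP/val_inj/mnmP => i /=; have [iA|niA] := boolP (i \in A); last first.
    have /andP[_ /forallP w0] := Pw.
    by rewrite (eqP (implyP (w0 i) niA)) (eqP (implyP (v0 i) niA)).
  apply/eqP; rewrite eqn_leq le_wv //= leqNgt; apply/negP => lt.
  have : (\sum_(i in A) w i < \sum_(i in A) v i)%N.
    rewrite (bigD1 i iA) /= [X in (_ < X)%N](bigD1 i iA) /= -addSn leq_add //.
    by rewrite leq_sum // => l /andP[lA _]; apply: le_wv.
  by rewrite !sum_v // ltnn.
exact: mon_val_power_ideal lti.
Qed.

Lemma cofactor_pow A j M : #|A| = c -> (j <= \sum_(i in A) M i)%N ->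
  ideal_pow star j (cofactor A ^+ j * mon_val F M).
Proof.
move=> cA; elim: j M => [|j IHj] M leM; first exact: ideal_pow0.
have /exists_inP[i iA Mi] : [exists i in A, (0 < M i)%N].
  apply: contraLR leM => /exists_inPn M0; rewrite -leqNgt big1 // => i /M0.
  by rewrite -eqn0Ngt => /eqP.
have leU : (U_(i) <= M)%MM.
  by apply/mnm_lepP => l; rewrite mnm1E; case: eqP => // <-.
rewrite (mon_val_dvd F leU) mon_valU exprS.
have -> (v w f y : R) : v * w * (y * f) = (v * f) * (w * y) by ring.
apply: ideal_powS.
  by apply: cofactor_star => //; apply: ideal_span_gen; apply: image_f.
have rest : (\sum_(l in A | l != i) (M - U_(i))%MM l = \sum_(l in A | l != i) M l)%N.
  by apply: eq_bigr => l /andP[_ ne]; rewrite mnmBE mnm1E eq_sym (negPf ne) subn0.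
apply: IHj; move: leM; rewrite (bigD1 i) //= [X in _ -> (_ <= X)%N](bigD1 i) //=.
rewrite rest mnmBE mnm1E eqxx; move: (\sum_(l in A | _) _)%N => r; lia.
Qed.

(** A prime P = (I : y) associated to the star ideal does not contain the
    cofactor of A, for any A whose ideal does not contain y; and the m-th
    power of the cofactor moves all monomials of weight at least m in A into
    I^m. *)
Lemma weight_symbolic_power m X :
  (forall x, X x -> exists2 M : 'X_{1..s}, x = mon_val F M &
     forall A, #|A| = c -> (m <= \sum_(i in A) M i)%N) ->
  forall x, ideal_span X x -> symbolic_power star m x.
Proof.
move=> XM x xX P [[[P0 PD PM] nP1 primeP] [y ey]].
have [A nA] : exists A : {set 'I_s}, ~ (#|A| = c -> form_ideal A y).
  by apply: not_all_ex_not => yI; apply/nP1/ey; rewrite /colon mul1r.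
have [cA nyA] := imply_to_and _ _ nA.
exists (cofactor A ^+ m).
  elim: m {XM} => [//|m IHm]; rewrite exprS => /primeP[] // /ey.
  by rewrite /colon mulrC => /(_ A cA)/(cofactor_nzd cA).
have idI := ideal_pow_ideal star m.
move: x xX; apply: (ideal_span_min (J := fun x => ideal_pow star m (_ * x))).
  split.
  - by rewrite mulr0; apply: is_ideal0.
  - by move=> z z' Wz Wz'; rewrite mulrDr; apply: is_idealD.
  - by move=> a z Wz; rewrite mulrCA; apply: is_idealMl.
by move=> _ /XM[M -> leM]; apply: cofactor_pow => //; apply: leM.
Qed.

(** Here the linear quotients replace the unmixedness of the ideal h: x is
    multiplied into h by the monomials with large exponents outside a c-set,
    and saturation removes these monomials one form at a time. *)
Lemma weight_ideals_cap m (G : seq 'X_{1..s}) x :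
  let h := [seq mon_val F M | M <- G] in
  (c <= s)%N -> G =i in_G c m ->
  (forall i, (i < size h)%N -> exists2 B : {set 'I_s}, (#|B| < c)%N &
     same_ideal (colon (ideal_of (take i h)) h`_i) (form_ideal B)) ->
  (forall A, #|A| = c -> weight_ideal A m x) -> ideal_of h x.
Proof.
move=> h le_cs GE quo xW; have idh : is_ideal (ideal_of h) by apply: ideal_span_ideal.
suff xN N : ideal_of h (x * mon_val F N).
  by have := xN 0%MM; rewrite mon_val0 mulr1.
(* Induction on the total by which the exponents of N fall short of m. *)
have [b] := ubnP (\sum_i (m - N i))%N; elim: b N => // b IHb N; rewrite ltnS => leb.
pose C := [set i | (N i < m)%N]; have [cC|ltC] := leqP #|C| c; last first.
  apply: (linear_quotients_saturated regF ltC quo) => i; rewrite inE => ltNi.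
  rewrite -mulrA -mon_valU -mon_valD; apply: IHb; apply: leq_trans leb.
  rewrite (bigD1 i) //= [X in (_ < X)%N](bigD1 i) //= -addSn leq_add //.
    by rewrite mnmDE mnm1E eqxx; lia.
  by apply: leq_sum => l _; rewrite mnmDE; lia.
have [|A sCA cA] := @exists_superset s C c; first by rewrite cC.
have xA := xW A cA; move: x xA {IHb xW}; apply: (ideal_span_min (J := fun x => ideal_of h (x * _))).
  split.
  - by rewrite mul0r; apply: is_ideal0.
  - by move=> z z' Wz Wz'; rewrite mulrDl; apply: is_idealD.
  - by move=> a z Wz; rewrite -mulrA; apply: is_idealMl.
move=> _ [M leM ->]; rewrite -mon_valD.
have [|M0 GM0 leM0] := @in_G_below s c m (M + N)%MM le_cs.
  apply: (Sdeg_ge (A := A)) => // [i niA|].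
    rewrite mnmDE (leq_trans _ (leq_addl _ _)) // leqNgt.
    by apply: contra niA => lt; apply: (subsetP sCA); rewrite inE.
  by under eq_bigr do rewrite mnmDE; rewrite big_split (leq_trans leM) ?leq_addr.
rewrite (mon_val_dvd F leM0); apply: is_idealMl => //.
by apply: ideal_span_gen; apply: map_f; rewrite GE.
Qed.

End SymbolicPower.

(** * The linear quotients of the symbolic powers *)

Lemma regular_seq_take (R : comNzRingType) (f : seq R) r :
  regular_seq f -> regular_seq (take r f).
Proof.
case=> nf1 reg; split=> [/(ideal_of_sub (@mem_take _ _ _))//|i].
rewrite size_take_min leq_min => /andP[ltir lti] x.
by rewrite take_takel ?(ltnW ltir) // nth_take //; apply: reg.
Qed.

(** A list of at most c + 1 distinct indices is a prefix of one of c + 1. *)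
Lemma regular_forms (R : comNzRingType) s c (F : 'I_s -> R) : c < s ->
  (forall j : 'I_c.+1 -> 'I_s, injective j -> regular_seq [seq F (j i) | i : 'I_c.+1]) ->
  forall l : seq 'I_s, uniq l -> size l <= c.+1 -> regular_seq [seq F i | i <- l].
Proof.
move=> lt_cs reg l uniq_l le_lc; pose l' := l ++ [seq i <- enum 'I_s | i \notin l].
have uniq_l' : uniq l'.
  rewrite cat_uniq uniq_l filter_uniq ?enum_uniq // andbT /=; apply/hasPn => i.
  by rewrite mem_filter => /andP[].
have size_l' : size l' = s.
  rewrite -[RHS]card_ord cardE; apply/perm_size/uniq_perm => // [|i].
    exact: enum_uniq.
  by rewrite mem_cat mem_filter mem_enum andbT orbN.
pose i0 := Ordinal (leq_trans (ltn0Sn c) lt_cs); pose j (i : 'I_c.+1) := nth i0 l' i.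
have ltj (i : 'I_c.+1) : i < size l' by rewrite size_l'; apply: leq_trans (ltn_ord i) lt_cs.
have inj_j : injective j.
  by move=> i i' /eqP; rewrite nth_uniq // => /eqP/val_inj.
have := regular_seq_take (size l) (reg j inj_j); congr regular_seq.
have size_j : size [seq F (j i) | i : 'I_c.+1] = c.+1 by rewrite size_map size_enum_ord.
apply: (@eq_from_nth _ (F i0)); first by rewrite size_takel ?size_j // size_map.
move=> i; rewrite size_takel ?size_j // => lti; have lti' := leq_trans lti le_lc.
rewrite nth_take // (nth_map i0) // (nth_map (Ordinal lti')) ?size_enum_ord //.
by rewrite /j nth_enum_ord // nth_cat lti.
Qed.

Section TauDecreasing.
Variables (s c : nat).
Implicit Types (M N : 'X_{1..s}) (G : seq 'X_{1..s}).

Lemma tau_decreasing_take x0 G i N : tau_decreasing c G -> i < size G ->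
  N \in take i G -> tau c N (nth x0 G i).
Proof.
elim: G i => [|M G IHG] [|i] //= [tauM dG] lti; rewrite inE => /predU1P[->|].
  by apply/tauM/mem_nth.
exact: IHG.
Qed.

Lemma tau_decreasing_mem x0 G i N : tau_decreasing c G -> i < size G ->
  N \in G -> tau c N (nth x0 G i) -> N \in take i G.
Proof.
elim: G i => [|M G IHG] [|i] //= [tauM dG] lti; rewrite inE => /predU1P[->|NG] tauN.
- by case: (tau_irr tauN).
- by case: (tau_irr (tau_trans tauN (tauM N NG))).
- exact: mem_head.
- by rewrite inE IHG ?orbT.
Qed.

End TauDecreasing.

Section MinGens.
Variables (n : nat) (k : fieldType).
Implicit Types (I J : {mpoly k[n]} -> Prop).

Lemma min_gens_same I J S : same_ideal I J -> min_gens J S -> min_gens I S.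
Proof.
move=> IJ [formS JS minS]; split=> //; first by move=> x; rewrite IJ.
by move=> S' sub IS'; apply: minS => // x; rewrite -IJ.
Qed.

Lemma is_form_mon_val s (F : 'I_s -> {mpoly k[n]}) (M : 'X_{1..s}) :
  (forall i, is_form (F i)) -> is_form (mon_val F M).
Proof.
move=> formF; rewrite /mon_val; elim/big_ind: _ => [|x y [d hx] [e hy]|i _].
- by exists 0; apply: dhomog1.
- by exists (d + e); apply: dhomogM.
- by have [d hd] := formF i; exists (d * M i); apply: dhomogMn.
Qed.

End MinGens.

Section CiQuotients.
Local Open Scope ring_scope.
Variables (k : fieldType) (n c s m : nat) (F : 'I_s -> {mpoly k[n]}).
Hypotheses (c_gt0 : (0 < c)%N) (lt_cs : (c < s)%N) (m_gt0 : (0 < m)%N).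
Hypothesis formF : forall i, is_form (F i).
Hypothesis regF : forall l : seq 'I_s, uniq l -> (size l <= c.+1)%N ->
  regular_seq [seq F i | i <- l].
Variable G : seq 'X_{1..s}.
Hypotheses (GE : G =i in_G c m) (uniq_G : uniq G) (dG : tau_decreasing c G).

Notation form_ideal A := (ideal_of [seq F i | i in A]).
Notation h := [seq mon_val F M | M <- G].
Let le_cs : (c <= s)%N := ltnW lt_cs.
Implicit Types (M N : 'X_{1..s}).

Lemma card_colon_set_lt M : in_G c m M -> (#|colon_set M| < c)%N.
Proof.
move=> GM; set E := layer M (height M).-1.
have le_CE : (#|colon_set M| <= #|~: E|)%N by apply/subset_leq_card/colon_set_sub.
have : (s - c < #|E|)%N.
  have [_ big] := in_GP _ _ le_cs GM; apply: big.
  by rewrite prednK // (in_G_height_gt0 lt_cs m_gt0 GM).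
have := cardsC E; rewrite card_ord; lia.
Qed.

(** The ideal (F_j^(M_j + 1) : j in the colon set) contains all monomials that
    precede M, so the colon ideal is not larger than asserted. *)
Lemma colon_idealE i : (i < size G)%N ->
  let M := nth 0%MM G i in
  same_ideal (colon (ideal_of (take i h)) h`_i) (form_ideal (colon_set M)).
Proof.
move=> lti M; have GM : in_G c m M by have := mem_nth 0%MM lti; rewrite GE.
rewrite (nth_map 0%MM) // -map_take -/M => x; split; rewrite /colon.
  move=> xM; apply: (form_ideal_colon regF (M := M)).
    exact/ltnW/card_colon_set_lt.
  move: xM; apply: ideal_span_min; first exact: power_ideal_ideal.
  move=> _ /mapP[N NG ->].
  have [||j jC ltj] := @tau_colon_set s c m M lt_cs m_gt0 GM N.
  - by have := mem_take NG; rewrite GE.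
  - exact: tau_decreasing_take.
  - exact: mon_val_power_ideal ltj.
have idh : is_ideal (ideal_of [seq mon_val F N | N <- take i G]) by apply: ideal_span_ideal.
move: x; apply: (ideal_span_min (colon_ideal (mon_val F M) idh)).
move=> _ /imageP[j jC ->]; rewrite /colon.
have [N [GN tauN] leN] := colon_set_tau lt_cs m_gt0 GM jC.
rewrite mulrC -(mon_valU F) -mon_valD (mon_val_dvd F leN); apply: is_idealMl => //.
have NG : N \in G by rewrite GE.
by apply/ideal_span_gen/map_f; apply: tau_decreasing_mem dG lti NG tauN.
Qed.

Lemma colon_set_first : (0 < size G)%N -> colon_set (nth 0%MM G 0) = set0.
Proof.
move=> lt0; apply/eqP; rewrite -subset0; apply/subsetP => j jC.
have GM : in_G c m (nth 0%MM G 0) by have := mem_nth 0%MM lt0; rewrite GE.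
have [N [GN tauN] _] := colon_set_tau lt_cs m_gt0 GM jC.
have NG : N \in G by rewrite GE.
by have := tau_decreasing_mem dG lt0 NG tauN; rewrite take0.
Qed.

Lemma form_ideal_min_gens (B : {set 'I_s}) : (#|B| <= c)%N ->
  min_gens (form_ideal B) [seq F i | i in B].
Proof.
move=> cB; apply: min_gens_map => [|i _|i iB]; [exact: enum_uniq|exact: formF|].
rewrite mem_enum in iB.
have sub : {subset [seq F u | u <- enum B & u != i] <= [seq F u | u in B :\ i]}.
  move=> _ /mapP[u + ->]; rewrite mem_filter mem_enum => /andP[ne uB].
  by apply: image_f; rewrite !inE ne.
have cBi : (#|B :\ i| <= c)%N by apply: leq_trans cB; apply/subset_leq_card/subD1set.
move=> /(ideal_of_sub sub); rewrite -[F i]mul1r => /(form_nzd regF cBi).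
by rewrite !inE eqxx => /(_ isT)/(form_ideal_proper regF cBi).
Qed.

Lemma colon_set_is_set i : (i < size G)%N ->
  is_set h i [seq F j | j in colon_set (nth 0%MM G i)].
Proof.
move=> lti; have GM : in_G c m (nth 0%MM G i) by have := mem_nth 0%MM lti; rewrite GE.
case: i lti GM => [|i] lti GM.
  by rewrite /= colon_set_first // /image_mem enum_set0.
apply: min_gens_same (colon_idealE lti) _.
exact/form_ideal_min_gens/ltnW/card_colon_set_lt.
Qed.

Lemma card_set_colon_set M : M \in G -> card_set_is h (index M G) #|colon_set M|%:Z.
Proof.
move=> MG; have lti : (index M G < size G)%N by rewrite index_mem.
have := colon_set_is_set lti; rewrite nth_index // => setM.
split; first by eexists; apply: setM.
move=> S setS; congr Posz; rewrite -(size_image F); move: setM setS.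
by case: (index M G) => [|i] /=; [move=> -> -> | move=> mS mS'; apply: min_gens_size mS' mS].
Qed.

Lemma generators_min_gens : min_gens (ideal_of h) h.
Proof.
apply: min_gens_map => // [M _|M]; first exact: is_form_mon_val.
rewrite GE => GM; have [|A cA sepA] := @in_G_separated s c m M _ m_gt0 GM.
  by rewrite c_gt0.
have leA : (#|A| <= c)%N by rewrite cA.
move=> MI; apply: (form_ideal_proper regF leA).
apply: (form_ideal_colon regF (M := M)) => //; rewrite mul1r.
move: MI; apply: ideal_span_min; first exact: power_ideal_ideal.
move=> _ /mapP[N + ->]; rewrite mem_filter => /andP[ne NG].
have [|i iA lti] := sepA N _ ne; first by have := NG; rewrite GE.
exact: mon_val_power_ideal lti.
Qed.

Lemma symbolic_power_generators :
  same_ideal (symbolic_power (star_ideal F c) m) (ideal_of h).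
Proof.
move=> x; split=> [xsym|].
  apply: (weight_ideals_cap regF le_cs GE) => [i|A cA].
    rewrite size_map => lti.
    have GM : in_G c m (nth 0%MM G i) by have := mem_nth 0%MM lti; rewrite GE.
    exists (colon_set (nth 0%MM G i)); [exact: card_colon_set_lt | exact: colon_idealE].
  exact: (symbolic_power_weight (@noetherian_mpoly k n) regF cA xsym).
apply: (weight_symbolic_power regF) => _ /mapP[M MG ->]; exists M => // A cA.
rewrite GE in MG; have [<- _] := in_GP _ _ le_cs MG.
exact: Sdeg_le_sum.
Qed.

Lemma symbolic_power_ci_quotients :
  ci_quotients (symbolic_power (star_ideal F c) m) h.
Proof.
split; first exact: min_gens_same symbolic_power_generators generators_min_gens.
move=> i /andP[_]; rewrite size_map => lti.
have GM : in_G c m (nth 0%MM G i) by have := mem_nth 0%MM lti; rewrite GE.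
exists [seq F j | j in colon_set (nth 0%MM G i)]; last exact: colon_idealE.
apply: regF; first exact: enum_uniq.
by rewrite -cardE; apply/leqW/ltnW/card_colon_set_lt.
Qed.

Lemma symbolic_power_delta_ci_quotients delta : (forall i, F i \is delta.-homog) ->
  delta_ci_quotients delta (symbolic_power (star_ideal F c) m) h.
Proof.
move=> homF; split; first exact: symbolic_power_ci_quotients.
move=> [|i] S; rewrite size_map => lti; first by move=> /= ->.
apply: min_gens_homog (colon_idealE lti) _.
by move=> _ /imageP[j _ ->].
Qed.

End CiQuotients.

Theorem theorem6p13 (k : fieldType) (n c s : nat) (hc : 1 <= c) (hcs : c < s)
    (F : 'I_s -> {mpoly k[n.+1]}) (hF : forall i, is_form (F i))
    (hreg : forall j : 'I_c.+1 -> 'I_s, injective j ->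
              regular_seq [seq F (j i) | i : 'I_c.+1])
    (m : nat) (hm : 1 <= m) :
  exists G : seq 'X_{1..s},
    let h := [seq mon_val F M | M <- G] in
    let I := symbolic_power (star_ideal F c) m in
    [/\ tau_listing c m G,
        ci_quotients I h,
        (forall M, M \in G ->
           let d := part c M in
           let d_t := last 0 d in
           let set_card := card_set_is h (index M G) in
           forall q r, m = q * c + r -> 1 <= r <= c ->
             (d = rcons (nseq q c) r ->
                set_card ((mfun [set: 'I_s] (factor c M r))%:Z
                          - s%:Z + c%:Z - r%:Z)%R)
             /\
             (d <> rcons (nseq q c) r ->
                exists2 i0, is_overlap_index c m d i0 &
                  let d_i0 := nth 0 d i0.-1 in
                  (d_t = d_i0 -> set_card (c%:Z - d_i0%:Z)%R)
                  /\
                  (d_t < d_i0 ->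
                     set_card (c%:Z - d_i0%:Z
                       + (mfun (factor c M d_i0) (factor c M d_t))%:Z
                       - (s%:Z - c%:Z + d_t%:Z))%R)))
      & forall delta : nat, (forall i, F i \is delta.-homog) ->
          delta_ci_quotients delta I h].
Proof.
have regF := regular_forms hcs hreg; have le_cs := ltnW hcs.
have [l uniq_l lE] := @in_G_finite s c m hcs.
have [G dG pG] := tau_sort c uniq_l.
have GE : G =i in_G c m by move=> M; rewrite (perm_mem pG) lE.
have uniq_G : uniq G by rewrite (perm_uniq pG).
exists G => h I; split=> //.
- exact: (symbolic_power_ci_quotients hc hcs hm hF regF GE uniq_G dG).
- move=> M MG d d_t set_card q r em hr; have GM : in_G c m M by have := MG; rewrite GE.
  have cardM : set_card (#|colon_set M|%:Z)%R.
    exact: (card_set_colon_set hc hcs hm hF regF GE uniq_G dG).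
  have ht_gt0 := in_G_height_gt0 hcs hm GM.
  have ht_last : (height M).-1 < height M by rewrite prednK.
  have card_eq := card_colon_set hcs hm GM.
  have [card_last last_gt0] := in_G_excess le_cs GM ht_last.
  have e_last : d_t = excess c M (height M).-1 by apply: last_part.
  split=> [ed|ne].
    have eh : height M = q.+1 by rewrite -(size_part c) -/d ed size_rcons size_nseq.
    have er : r = excess c M (height M).-1 by rewrite -e_last /d_t ed last_rcons.
    have -> : factor c M r = layer M (height M).-1.
      by rewrite er (factor_excess hcs GM).
    have eD : penultimate M = [set: 'I_s].
      case: q {em} eh ed => [|q] eh ed; first by apply/setP => i; rewrite !inE eh.
      apply/eqP; rewrite penultimate_layer ?eh // eqEcard subsetT cardsT card_ord.
      have [|-> _] := @in_G_excess s c m M q le_cs GM; first by rewrite eh ltnW.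
      by rewrite -nth_part -/d ed nth_rcons size_nseq ltnSn nth_nseq ltnSn /= subnKC.
    move: cardM card_eq; rewrite eD cardsT card_ord card_last -er /set_card => cardM card_eq.
    suff -> : ((mfun [set: 'I_s] (layer M (height M).-1))%:Z - s%:Z + c%:Z - r%:Z =
      #|colon_set M|%:Z)%R by [].
    by lia.
  exists (index (excess c M (height M).-2) d).+1.
    exact: (overlap_index hcs hm GM em hr ne).
  have ht_gt1 := not_max_height hcs hm GM em hr ne.
  have lt2 : (height M).-2 < height M by lia.
  have lt_pc := not_max_excess hcs hm GM em hr ne.
  have [card_pen _] := in_G_excess le_cs GM lt2.
  move=> d_i0; have -> : d_i0 = excess c M (height M).-2.
    by rewrite /d_i0 /= nth_index // -nth_part mem_nth ?size_part.
  rewrite (penultimate_layer ht_gt1) card_pen card_last -e_last in card_eq.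
  rewrite e_last (factor_excess hcs GM ht_last) (factor_excess hcs GM lt2).
  rewrite -e_last; split=> [e|lt].
    have eL : layer M (height M).-1 = layer M (height M).-2.
      by apply: (layer_excess hcs GM); rewrite // -e_last.
    have e_mfun : mfun (layer M (height M).-2) (layer M (height M).-2) =
        #|layer M (height M).-2|.
      rewrite mfunE //; apply: eq_card => y; rewrite inE; apply: andb_idr => yL.
      by apply/exists_inP; exists y.
    move: card_eq; rewrite eL e_mfun card_pen e => card_eq.
    suff -> : (c%:Z - (excess c M (height M).-2)%:Z = #|colon_set M|%:Z)%R by [].
    by lia.
  set z := (_ - _)%R; suff -> : (z = #|colon_set M|%:Z)%R by [].
  by rewrite /z; lia.
- by move=> delta homF; apply: symbolic_power_delta_ci_quotients.
Qed.
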